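(* There is a polynomial-time algorithm that, given $n$ points in the Euclidean plane and a positive integer $k\le n$, constructs a tree spanning at least $k$ of these points such that the total length of the tree is at most $O(k^{1/4})$ times that of a minimum-length tree spanning any $k$ of the points.
   Context: A tree spanning a subset of the points is a tree whose vertices are the points of the subset, each edge having length equal to the Euclidean distance between its endpoints; the length of the tree is the sum of its edge lengths. The minimum is over all choices of $k$ of the points and all trees spanning them. The constant hidden in $O(\cdot)$ is absolute. *)

(* Defs.v *)
From HB Require Import structures.
From mathcomp Require Import all_boot all_order all_algebra.
From mathcomp Require Import reals exp.

Set Implicit Arguments.
Unset Strict Implicit.
Unset Printing Implicit Defensive.

Import Order.TTheory GRing.Theory Num.Theory.
Local Open Scope ring_scope.

(** * The real RAM

    Polynomial time is measured on the real RAM of computational geometry,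
    presented as structured programs over a memory made of arrays of natural
    numbers and arrays of real numbers (cell [i] of array [a] is [mem a i]; a
    program names finitely many arrays, and the index may be computed).
    - Naturals support only addition and truncated subtraction, so that a run
      of [t] steps cannot build naturals of more than O(t) additional bits.
    - Reals support exact field operations and square roots (needed to compare
      Euclidean lengths). The only program constants are natural numbers, and
      there is no rounding: reals influence naturals only through comparisons.
    Programs do not depend on the size of the input nor on the type of reals. *)

Inductive nexp : Type :=
  | NConst of nat
  | NCell of nat & nexp
  | NAdd of nexp & nexp
  | NSub of nexp & nexp.

Inductive rexp : Type :=
  | RNat of nexp
  | RCell of nat & nexp
  | RAdd of rexp & rexp
  | RSub of rexp & rexp
  | RMul of rexp & rexp
  | RDiv of rexp & rexp
  | RSqrt of rexp.

Inductive bexp : Type :=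
  | BLtN of nexp & nexp
  | BLtR of rexp & rexp
  | BNot of bexp
  | BAnd of bexp & bexp.

Inductive cmd : Type :=
  | Skip
  | NStore of nat & nexp & nexp (* [NStore a i e] is  a[i] := e *)
  | RStore of nat & nexp & rexp
  | Seq of cmd & cmd
  | If of bexp & cmd & cmd
  | While of bexp & cmd.

Record state (R : realType) : Type := State {
  nmem : nat -> nat -> nat;
  rmem : nat -> nat -> R }.

Definition upd (V : Type) (m : nat -> nat -> V) (a i : nat) (v : V) :
    nat -> nat -> V :=
  fun b j => if (b == a) && (j == i) then v else m b j.

Fixpoint neval (R : realType) (s : state R) (e : nexp) : nat :=
  match e with
  | NConst c => c
  | NCell a i => nmem s a (neval s i)
  | NAdd e1 e2 => (neval s e1 + neval s e2)%N
  | NSub e1 e2 => (neval s e1 - neval s e2)%N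
  end.

(* As everywhere in MathComp, x / 0 = 0 and Num.sqrt x = 0 for x < 0. *)
Fixpoint reval (R : realType) (s : state R) (e : rexp) : R :=
  match e with
  | RNat i => (neval s i)%:R
  | RCell a i => rmem s a (neval s i)
  | RAdd e1 e2 => reval s e1 + reval s e2
  | RSub e1 e2 => reval s e1 - reval s e2
  | RMul e1 e2 => reval s e1 * reval s e2
  | RDiv e1 e2 => reval s e1 / reval s e2
  | RSqrt e1 => Num.sqrt (reval s e1)
  end.

Fixpoint beval (R : realType) (s : state R) (b : bexp) : bool :=
  match b with
  | BLtN e1 e2 => (neval s e1 < neval s e2)%N
  | BLtR e1 e2 => reval s e1 < reval s e2
  | BNot b1 => ~~ beval s b1
  | BAnd b1 b2 => beval s b1 && beval s b2
  end.

(* [exec c s t s']: started in [s], the program [c] halts in [s'] after [t]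
   steps. Assignments and tests have unit cost: the expressions of a fixed
   program have bounded size. *)
Inductive exec (R : realType) : cmd -> state R -> nat -> state R -> Prop :=
  | exec_skip s : exec Skip s 1 s
  | exec_nstore a i e s :
      exec (NStore a i e) s 1
        (State (upd (nmem s) a (neval s i) (neval s e)) (rmem s))
  | exec_rstore a i e s :
      exec (RStore a i e) s 1
        (State (nmem s) (upd (rmem s) a (neval s i) (reval s e)))
  | exec_seq c1 c2 s t1 s1 t2 s2 :
      exec c1 s t1 s1 -> exec c2 s1 t2 s2 -> exec (Seq c1 c2) s (t1 + t2) s2
  | exec_if_true b c1 c2 s t s1 :
      beval s b -> exec c1 s t s1 -> exec (If b c1 c2) s t.+1 s1
  | exec_if_false b c1 c2 s t s1 :
      ~~ beval s b -> exec c2 s t s1 -> exec (If b c1 c2) s t.+1 s1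
  | exec_while_false b c s : ~~ beval s b -> exec (While b c) s 1 s
  | exec_while_true b c s t1 s1 t2 s2 :
      beval s b -> exec c s t1 s1 -> exec (While b c) s1 t2 s2 ->
      exec (While b c) s (t1 + t2).+1 s2.

(** * Trees on points of the Euclidean plane *)

Definition edist (R : realType) (x y : R * R) : R :=
  Num.sqrt ((x.1 - y.1) ^+ 2 + (x.2 - y.2) ^+ 2).

(* A graph whose vertices are some of [n] indexed points. The undirected edge
   between i and j is stored once, as the pair with the smaller index first;
   this is enforced by [simple_graph]. *)
Record graph (n : nat) : Type := Graph {
  verts : {set 'I_n};
  edges : {set 'I_n * 'I_n} }.

Definition adj (n : nat) (G : graph n) : rel 'I_n :=
  fun i j => ((i, j) \in edges G) || ((j, i) \in edges G).

Definition simple_graph (n : nat) (G : graph n) : Prop :=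
  forall i j, (i, j) \in edges G ->
    [/\ (i < j)%N, i \in verts G & j \in verts G].

Definition connected_graph (n : nat) (G : graph n) : Prop :=
  verts G != set0 /\ {in verts G &, forall i j, connect (adj G) i j}.

Definition acyclic_graph (n : nat) (G : graph n) : Prop :=
  forall c : seq 'I_n, (2 < size c)%N -> ~ ucycle (adj G) c.

Definition is_tree (n : nat) (G : graph n) : Prop :=
  [/\ simple_graph G, connected_graph G & acyclic_graph G].

Definition tree_length (R : realType) (n : nat) (p : 'I_n -> R * R)
    (G : graph n) : R :=
  \sum_(e in edges G) edist (p e.1) (p e.2).

Definition min_ktree (R : realType) (n : nat) (p : 'I_n -> R * R) (k : nat)
    (T : graph n) : Prop :=
  [/\ is_tree T, #|verts T| = k &
      forall T' : graph n, is_tree T' -> #|verts T'| = k ->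
        tree_length p T <= tree_length p T'].

(** * Input and output conventions *)

(* n and k are in cell 0 of the natural arrays 0 and 1, the coordinates of the
   points are in the real arrays 0 and 1, and all the other cells contain 0. *)
Definition input (R : realType) (n k : nat) (p : 'I_n -> R * R) : state R :=
  State
    (fun a i => if i == 0%N then
                  if a == 0%N then n else if a == 1%N then k else 0%N
                else 0%N)
    (fun a i => if insub i is Some j then
                  if a == 0%N then (p j).1 else if a == 1%N then (p j).2 else 0
                else 0).

(* Vertices are listed without repetition in the natural array 3, their number
   being in cell 0 of array 2; the first and second endpoints of the edges are
   listed without repetition in the arrays 5 and 6, their number being in cell
   0 of array 4. *)
Definition output (R : realType) (n : nat) (s : state R) (G : graph n) : Prop :=
  perm_eq (mkseq (nmem s 3) (nmem s 2 0)) [seq val i | i in verts G] /\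
  perm_eq (mkseq (fun t => (nmem s 5 t, nmem s 6 t)) (nmem s 4 0))
          [seq (val e.1, val e.2) | e in edges G].

(* Main.v *)
Require Import Defs.
From HB Require Import structures.
From mathcomp Require Import all_boot all_order all_algebra.
From mathcomp Require Import reals exp.
From mathcomp Require Import zify ring lra.

Set Implicit Arguments.
Unset Strict Implicit.
Unset Printing Implicit Defensive.

Import Order.TTheory GRing.Theory Num.Theory.
Local Open Scope ring_scope.

(* The program guesses a vertex s of the optimal tree and a vertex j farthest
   from s in it, hence the disk of radius d = |s j| around s, and sets
   r = d / sqrt k. It covers k points of the disk greedily: each round picks the
   ball of radius r with the most new points and inserts the new points of the
   concentric ball of radius 3 r, each one joined to the nearest vertex inserted
   before it. The best tree over all guesses is returned.
   An optimal tree of length L satisfies d <= 2 L and, by cutting the walk that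
   doubles its edges into pieces of length r, is covered by m balls of radius r
   with (m - 1) r <= 2 L. The greedy choice then needs at most m rounds. Two
   vertices whose insertion costs are at least l are at distance at least l, so
   packing bounds the number of expensive insertions, and the total cost is
   O(d sqrt m) = O(sqrt (d ^ 2 + d L sqrt k)) = O(k ^ (1/4) L). *)

(** * Packing and covering in the plane *)

Section Metric.
Variable R : realType.

(** The value r = d / sqrt k balances two kinds of insertions. Those dearer than r number O(m), by
    packing in the at most m balls of radius 3 r that contain the vertices; sorting their costs
    against packing in the disk of radius d gives a total of O(d sqrt m). The cheap ones, at most k
    of them, are packed ball by ball and total O(r sqrt (m k)), which is the same quantity. The
    factor 3 comes from an exchange: a ball of radius r that meets the picked ball lies within 3 r
    of its centre, so each round can be charged to one ball of the unknown cover. Only k points have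
    to be covered, hence the charged ball need not meet the picked one: a ball with no more new
    points will do. The program knows neither the optimal tree nor m. It therefore always runs n
    rounds, enough for any cover without repeated centres. The surplus rounds are harmless: once the
    cover is used up the tree has k vertices, and insertion stops there. *)

Lemma edist_ge0 (x y : R * R) : 0 <= edist x y.
Proof. exact: sqrtr_ge0. Qed.

Lemma edistC (x y : R * R) : edist x y = edist y x.
Proof. by rewrite /edist; congr Num.sqrt; ring. Qed.

Lemma edistxx (x : R * R) : edist x x = 0.
Proof. by rewrite /edist !subrr expr0n addr0 sqrtr0. Qed.

Lemma edist_sqr (x y : R * R) : edist x y ^+ 2 = (x.1 - y.1) ^+ 2 + (x.2 - y.2) ^+ 2.
Proof. by rewrite sqr_sqrtr // addr_ge0 ?sqr_ge0. Qed.

Lemma edist_triangle (y x z : R * R) : edist x z <= edist x y + edist y z.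
Proof.
have [a0 b0] := (edist_ge0 x y, edist_ge0 y z).
rewrite -(@ler_pXn2r _ 2) ?nnegrE ?edist_ge0 ?addr_ge0 // sqrrD !edist_sqr.
set P := edist x y in a0 *; set Q := edist y z in b0 *.
have eP : P ^+ 2 = _ := edist_sqr x y; have eQ : Q ^+ 2 = _ := edist_sqr y z.
set u := x.1 - y.1 in eP *; set v := x.2 - y.2 in eP *.
set s := y.1 - z.1 in eQ *; set t := y.2 - z.2 in eQ *.
have -> : x.1 - z.1 = u + s by rewrite /u /s; ring.
have -> : x.2 - z.2 = v + t by rewrite /v /t; ring.
suff : u * s + v * t <= P * Q by lra.
apply: le_trans (ler_norm _) _.
rewrite -(@ler_pXn2r _ 2) ?nnegrE ?mulr_ge0 // real_normK ?num_real //.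
rewrite exprMn eP eQ -subr_ge0.
by rewrite (_ : _ - _ = (u * t - v * s) ^+ 2) ?sqr_ge0 //; ring.
Qed.

Lemma ler_abs_edist (x y : R * R) : `|x.1 - y.1| <= edist x y /\ `|x.2 - y.2| <= edist x y.
Proof.
by split; rewrite -(@ler_pXn2r _ 2) ?nnegrE ?edist_ge0 // real_normK ?num_real //
  edist_sqr; rewrite ?lerDl ?lerDr sqr_ge0.
Qed.

(* If the values of [f] are sorted in decreasing order, then the j-th one is
   at most sqrt (A / j), and the sum of the 1 / sqrt j is at most 2 sqrt n. *)
Lemma sum_le_sqrt_card (T : finType) (V : {set T}) (f : T -> R) (A : R) :
    (forall y, y \in V -> 0 <= f y) ->
    (forall y, y \in V -> 0 < f y ->
       #|[set z in V | f y <= f z]|%:R * f y ^+ 2 <= A) ->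
    0 <= A ->
  \sum_(y in V) f y <= 2 * Num.sqrt (A * #|V|%:R).
Proof.
elim: {V}#|V| {-2}V (erefl #|V|) => [|n IH] V eV f0 fA A0.
  rewrite eV mulr0 sqrtr0 mulr0 big1 // => y.
  by rewrite (cards0_eq eV) inE.
have [y0 y0V] : exists y, y \in V by apply/card_gt0P; rewrite eV.
case: (@Order.TotalTheory.arg_minP _ _ _ y0 (fun y => y \in V) f y0V) => y yV ymin.
have eV' : #|V :\ y| = n by apply/eqP; rewrite -eqSS -eV (cardsD1 y V) yV.
have H : \sum_(z in V :\ y) f z <= 2 * Num.sqrt (A * n%:R).
  rewrite -eV'; apply: IH => // [z|z]; rewrite !inE => /andP[_ zV]; first exact: f0.
  move=> z0; apply: le_trans (fA z zV z0).
  rewrite ler_wpM2r ?sqr_ge0 // ler_nat subset_leq_card //.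
  by apply/subsetP => t; rewrite !inE -andbA => /and3P[_ -> ->].
rewrite (big_setD1 y) //=; apply: le_trans (lerD (lexx _) H) _.
have a0 := f0 y yV; set a := f y in a0 *.
have aA : n.+1%:R * a ^+ 2 <= A.
  have [a_gt0|] := ltP 0 a; last first.
    by move=> a_le0; have -> : a = 0 by [lra]; rewrite expr0n mulr0.
  apply: le_trans (fA y yV a_gt0); rewrite ler_wpM2r ?sqr_ge0 // ler_nat -eV.
  by apply/subset_leq_card/subsetP => z zV; rewrite inE zV ymin.
rewrite eV; set S : R := Num.sqrt _; set U : R := Num.sqrt _.
have eS : S ^+ 2 = A * n%:R by rewrite sqr_sqrtr ?mulr_ge0.
have eU : U ^+ 2 = A * n%:R + A by rewrite sqr_sqrtr ?mulr_ge0 // -natr1; ring.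
have S0 : 0 <= S by exact: sqrtr_ge0.
have U0 : 0 <= U by exact: sqrtr_ge0.
have SU : S <= U by rewrite -(@ler_pXn2r _ 2) // eS eU lerDl.
have aU : a * U <= A.
  rewrite -(@ler_pXn2r _ 2) ?nnegrE ?mulr_ge0 // exprMn eU.
  by rewrite -natr1 in aA; nra.
have [a_eq0|a_neq0] := eqVneq a 0; first by lra.
have a_gt0 : 0 < a by rewrite lt_def a_neq0.
have A_gt0 : 0 < A by apply: lt_le_trans aA; rewrite mulr_gt0 ?exprn_gt0.
have U_gt0 : 0 < U by rewrite -(@ltr_pXn2r _ 2) ?nnegrE // eU expr0n /= ltr_wpDl // mulr_ge0.
(* The goal is a <= 2 (U - S), and U ^ 2 - S ^ 2 = A. Its negation times U + S reads 2 A < a (U +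
   S), against a S <= a U <= A. *)
rewrite leNgt; apply/negP => lt_a; suff : 2 * A < a * (U + S) by nra.
by have -> : A = U ^+ 2 - S ^+ 2 by [lra]; nra.
Qed.

(* Squares of side l / 2 contain at most one point of W each. *)
Lemma packing (T : finType) (p : T -> R * R) (W : {set T}) (c : R * R) (b l : R) :
    0 < l -> l <= 2 * b ->
    (forall y, y \in W -> edist c (p y) <= b) ->
    {in W &, forall y z, y != z -> l <= edist (p y) (p z)} ->
  #|W|%:R * l ^+ 2 <= 36 * b ^+ 2.
Proof.
move=> l0 lb Wb Wl.
pose cell (u v : R) := Num.truncn ((v - u + b) * 2 / l).
pose q := (Num.truncn (4 * b / l)).+1.
have b0 : 0 <= b by lra.
have in_cell u v : `|u - v| <= b ->
    [/\ (cell u v)%:R * l <= (v - u + b) * 2, (v - u + b) * 2 < (cell u v).+1%:R * l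
      & (cell u v < q)%N].
  rewrite ler_norml => /andP[h1 h2].
  have h0 : 0 <= (v - u + b) * 2 / l by rewrite divr_ge0 //; lra.
  have /andP[h3 h4] := truncn_itv h0; split.
  - by rewrite -ler_pdivlMr.
  - by rewrite -ltr_pdivrMr.
  - rewrite ltnS le_truncn // ler_wpM2r ?invr_ge0; lra.
have close u v v' : `|u - v| <= b -> `|u - v'| <= b -> cell u v = cell u v' ->
    (v - v') ^+ 2 < (l / 2) ^+ 2.
  move=> /in_cell[h1 h2 _] /in_cell[h3 h4 _] e; rewrite e in h1 h2.
  rewrite -[(cell u v').+1%:R]natr1 [(_ + 1) * l]mulrDl mul1r in h2 h4.
  have [p1 p2] : 0 < l / 2 - (v - v') /\ 0 < l / 2 + (v - v') by split; lra.
  by have := mulr_gt0 p1 p2; lra.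
pose g y : 'I_q * 'I_q := (inord (cell c.1 (p y).1), inord (cell c.2 (p y).2)).
have g_inj : {in W &, injective g}.
  move=> y z yW zW [/(congr1 val) e1 /(congr1 val) e2]; apply: contraTeq isT => yz.
  have [y1 y2] := ler_abs_edist c (p y); have [z1 z2] := ler_abs_edist c (p z).
  have [yb zb] := (Wb y yW, Wb z zW).
  have := in_cell _ _ (le_trans y1 yb); have := in_cell _ _ (le_trans y2 yb).
  have := in_cell _ _ (le_trans z1 zb); have := in_cell _ _ (le_trans z2 zb).
  move=> [_ _ k1] [_ _ k2] [_ _ k3] [_ _ k4].
  rewrite /= !inordK // in e1 e2.
  (* Two points in one square differ by less than l / 2 in each coordinate, so their squared
     distance is below l ^ 2 / 2. *)
  have c1 := close _ _ _ (le_trans y1 yb) (le_trans z1 zb) e1.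
  have c2 := close _ _ _ (le_trans y2 yb) (le_trans z2 zb) e2.
  have lyz := Wl y z yW zW yz.
  have : l ^+ 2 <= edist (p y) (p z) ^+ 2 by rewrite ler_pXn2r ?nnegrE ?edist_ge0 // ltW.
  by rewrite edist_sqr; nra.
have : (#|W| <= q * q)%N.
  by rewrite -(card_in_imset g_inj) (leq_trans (max_card _)) // card_prod card_ord.
rewrite -(ler_nat R) natrM => Wq.
(* Since q <= 4 b / l + 1 and l <= 2 b, q l <= 4 b + l <= 6 b; this is the origin of 36. *)
have : q%:R * l <= 6 * b.
  rewrite /q -natr1 mulrDl mul1r; suff : (Num.truncn (4 * b / l))%:R * l <= 4 * b by lra.
  by rewrite -ler_pdivlMr // truncn_le divr_ge0 //; lra.
have : 0 <= q%:R * l by rewrite mulr_ge0 // ltW.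
move: Wq; move: (#|W|%:R) (q%:R) => w Q; nra.
Qed.

Lemma card_cover (T I : finType) (Q : I -> pred T) (xs : seq I) (H : {set T}) (b : R) :
    (forall y, y \in H -> exists2 x, x \in xs & Q x y) ->
    (forall x, #|[set y in H | Q x y]|%:R <= b) ->
  #|H|%:R <= (size xs)%:R * b.
Proof.
elim: xs H => [|x xs IH] H HQ Hb.
  rewrite mul0r; have -> : H = set0; last by rewrite cards0.
  by apply/setP => y; rewrite inE; apply/negP => /HQ[].
rewrite /= -natr1 mulrDl mul1r addrC.
have -> : #|H|%:R = #|H :&: [set y | Q x y]|%:R + #|H :\: [set y | Q x y]|%:R :> R.
  by rewrite -natrD cardsID.
apply: lerD.
  by apply: le_trans (Hb x); rewrite ler_nat subset_leq_card // setIdE.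
apply: IH => [y|x'].
  rewrite !inE => /andP[nQ /HQ[x']]; rewrite inE => /predU1P[->|]; first by rewrite (negbTE nQ).
  by exists x'.
apply: le_trans (Hb x'); rewrite ler_nat subset_leq_card //.
by apply/subsetP => y; rewrite !inE -!andbA => /and3P[_ -> ->].
Qed.

(* The two halves of the sum, f > r and f <= r, are controlled by packing in
   the ball of radius d and in the balls of radius 3 r, respectively. *)
Lemma insertion_cost (T : finType) (p : T -> R * R) (V : {set T}) (f : T -> R)
    (c : R * R) (xs : seq T) (d r : R) :
    0 <= r -> d = r * Num.sqrt #|V|%:R ->
    (forall y, y \in V -> edist c (p y) <= d) ->
    (forall y, y \in V -> exists2 x, x \in xs & edist (p x) (p y) <= 3 * r) ->
    (forall y, y \in V -> 0 <= f y <= 2 * d) ->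
    {in V &, forall y z, y != z ->
       f y <= edist (p y) (p z) \/ f z <= edist (p y) (p z)} ->
  \sum_(y in V) f y <= 252 * d * Num.sqrt (size xs)%:R.
Proof.
move=> r0 ed Vd Vr Vf Vsep.
have d0 : 0 <= d by rewrite ed mulr_ge0 ?sqrtr_ge0.
have [er|] := eqVneq r 0.
  rewrite big1 => [|y /Vf /andP[]]; last by rewrite ed er mul0r mulr0; lra.
  by rewrite mulr_ge0 ?sqrtr_ge0 // mulr_ge0.
move=> r_neq0; have r_gt0 : 0 < r by rewrite lt_def r_neq0.
have sep (W : {set T}) l : {subset W <= V} -> (forall y, y \in W -> l <= f y) ->
    {in W &, forall y z, y != z -> l <= edist (p y) (p z)}.
  move=> sW Wl y z yW zW yz.
  by case: (Vsep y z (sW _ yW) (sW _ zW) yz) => h; apply: le_trans h; apply: Wl.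
have pack_d (W : {set T}) l : 0 < l -> l <= 2 * d -> {subset W <= V} ->
    (forall y, y \in W -> l <= f y) -> #|W|%:R * l ^+ 2 <= 36 * d ^+ 2.
  move=> l0 ld sW Wl; apply: (@packing _ p _ c) => //; last exact: sep.
  by move=> y /sW /Vd.
pose g : R := (size xs)%:R.
have pack_r (W : {set T}) l : 0 < l -> l <= r -> {subset W <= V} ->
    (forall y, y \in W -> l <= f y) -> #|W|%:R * l ^+ 2 <= g * (324 * r ^+ 2).
  move=> l0 lr sW Wl.
  suff : #|W|%:R <= g * (324 * r ^+ 2 / l ^+ 2).
    by rewrite mulrA ler_pdivlMr // exprn_gt0.
  apply: (@card_cover _ _ (fun x y => edist (p x) (p y) <= 3 * r)) => [y /sW /Vr //|x].
  rewrite ler_pdivlMr ?exprn_gt0 //.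
  have -> : 324 * r ^+ 2 = 36 * (3 * r) ^+ 2 by ring.
  have sW' : {subset [set y in W | edist (p x) (p y) <= 3 * r] <= W}.
    by move=> y; rewrite inE => /andP[].
  apply: (@packing _ p _ (p x)) => //; first by lra.
    by move=> y; rewrite inE => /andP[].
  by apply: sep => y /sW'; [exact: sW | exact: Wl].
have g0 : 0 <= g by [].
pose H := [set y in V | r < f y].
have sH : {subset H <= V} by move=> y; rewrite inE => /andP[].
pose L := [set y in V | ~~ (r < f y)].
have sL : {subset L <= V} by move=> y; rewrite inE => /andP[].
(* At the threshold l = r, packing allows at most 324 = 36 * 3 ^ 2 expensive insertions per ball of
   radius 3 r, a number free of k. *)
have cH : #|H|%:R <= 324 * g.
  have r2 : 0 < r ^+ 2 by rewrite exprn_gt0.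
  rewrite -(ler_pM2r r2).
  apply: le_trans (pack_r H r r_gt0 (lexx _) sH _) _; last by lra.
  by move=> y; rewrite inE => /andP[_ /ltW].
have -> : \sum_(y in V) f y = \sum_(y in H) f y + \sum_(y in L) f y.
  rewrite (bigID (fun y => r < f y)) /=.
  by congr (_ + _); apply: eq_bigl => y; rewrite inE.
have le_sqrt (a b : R) : 0 <= b -> a <= b ^+ 2 -> Num.sqrt a <= b.
  by move=> b0 ab; rewrite -[b]ger0_norm // -sqrtr_sqr ler_wsqrtr.
have sumH : \sum_(y in H) f y <= 2 * Num.sqrt (36 * d ^+ 2 * #|H|%:R).
  apply: sum_le_sqrt_card => [y /sH /Vf /andP[] //|y yH y0|].
    apply: pack_d => // [|z|z]; rewrite ?inE; first by case/andP: (Vf y (sH y yH)).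
      by rewrite -andbA => /and3P[].
    by case/andP.
  by rewrite mulr_ge0 // sqr_ge0.
have sumL : \sum_(y in L) f y <= 2 * Num.sqrt (g * (324 * r ^+ 2) * #|L|%:R).
  apply: sum_le_sqrt_card => [y /sL /Vf /andP[] //|y yL y0|].
    apply: pack_r => // [|z|z]; rewrite ?inE; first by move: yL; rewrite inE -leNgt => /andP[].
      by rewrite -andbA => /and3P[].
    by case/andP.
  by rewrite mulr_ge0 // mulr_ge0 // sqr_ge0.
have dg0 : 0 <= d * Num.sqrt g by rewrite mulr_ge0 ?sqrtr_ge0.
have boundH : Num.sqrt (36 * d ^+ 2 * #|H|%:R) <= 108 * (d * Num.sqrt g).
  apply: le_sqrt; first by lra.
  rewrite !exprMn sqr_sqrtr //; have := sqr_ge0 d; nra.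
have boundL : Num.sqrt (g * (324 * r ^+ 2) * #|L|%:R) <= 18 * (d * Num.sqrt g).
  apply: le_sqrt; first by lra.
  rewrite ed !exprMn !sqr_sqrtr //.
  have : #|L|%:R <= #|V|%:R :> R by rewrite ler_nat subset_leq_card //; apply/subsetP.
  move: (#|L|%:R) (#|V|%:R) => a b ab.
  have : 0 <= g * r ^+ 2 by rewrite mulr_ge0 ?sqr_ge0.
  nra.
(* 252 = 2 (108 + 18): the 2 is the factor of [sum_le_sqrt_card], 108 is the square root of 36 * 324
   and 18 that of 324. *)
rewrite -/g; lra.
Qed.

End Metric.

(** * Walks in connected graphs *)

Section Walks.
Variables (R : realType) (n : nat) (p : 'I_n -> R * R).
Let dist (i j : 'I_n) : R := edist (p i) (p j).

Fixpoint walk_length (x : 'I_n) (w : seq 'I_n) : R :=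
  if w is y :: w' then edist (p x) (p y) + walk_length y w' else 0.

Lemma walk_length_ge0 x w : 0 <= walk_length x w.
Proof. by elim: w x => //= y w IH x; rewrite addr_ge0 ?edist_ge0. Qed.

Lemma walk_length_cat x w1 w2 :
  walk_length x (w1 ++ w2) = walk_length x w1 + walk_length (last x w1) w2.
Proof. by elim: w1 x => [|y w1 IH] x /=; rewrite ?add0r // IH addrA. Qed.

Lemma dist_le_walk_length x w y : y \in x :: w -> dist x y <= walk_length x w.
Proof.
elim: w x => [|z w IH] x; first by rewrite inE => /eqP->; rewrite /dist edistxx.
rewrite inE => /predU1P[->|/IH h].
  by rewrite /dist edistxx walk_length_ge0.
by apply: le_trans (edist_triangle (p z) _ _) _; rewrite /= lerD2l.
Qed.

Lemma walk_cover (r : R) x w : 0 <= r -> exists J : seq 'I_n,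
  (forall y, y \in x :: w -> exists2 c, c \in x :: J & dist c y <= r) /\
  (size J)%:R * r <= walk_length x w.
Proof.
(* In the generalisation [c] is the last centre opened and [a] bounds the length walked since
   then. *)
move=> r0; suff H c a : 0 <= a -> dist c x <= a -> a <= r -> exists J : seq 'I_n,
    (forall y, y \in x :: w -> exists2 c', c' \in c :: J & dist c' y <= r) /\
    (size J)%:R * r <= a + walk_length x w.
  have [|J] := H x 0 (lexx _) _ r0; first by rewrite /dist edistxx.
  by rewrite add0r; exists J.
elim: w x c a => [|z w IH] x c a a0 cx ar.
  exists [::]; split; last by rewrite mul0r addr0.
  move=> y; rewrite inE => /eqP ->; exists c; rewrite ?mem_head //.
  exact: le_trans ar.
have xz := edist_ge0 (p x) (p z).
have [h|h] := leP (a + dist x z) r.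
  have [||J [HJ sJ]] := IH z c (a + dist x z) _ _ h.
  - exact: addr_ge0.
  - by apply: le_trans (edist_triangle (p x) _ _) _; rewrite lerD2r.
  exists J; split; last by rewrite /= addrA.
  move=> y; rewrite inE => /predU1P[->|/HJ //]; exists c; rewrite ?mem_head //.
  exact: le_trans ar.
(* The walk since [c] now exceeds r: this length pays for a new centre at [z], and the count
   restarts at 0. *)
have [|J [HJ sJ]] := IH z z 0 (lexx _) _ r0; first by rewrite /dist edistxx.
exists (z :: J); split; last first.
  by rewrite /= -natr1 mulrDl mul1r; rewrite /dist in h; lra.
move=> y; rewrite inE => /predU1P[->|/HJ [c' c'J c'y]].
  by exists c; rewrite ?mem_head //; exact: le_trans ar.
by exists c' => //; rewrite inE c'J orbT.
Qed.

(* Doubling the edges of a spanning tree, grown from the root one leaf at a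
   time: a new leaf [v] is visited by a detour from its neighbour. *)
Lemma walk_exists (G : graph n) (a : 'I_n) :
    simple_graph G -> connected_graph G -> a \in verts G ->
  exists w, {subset verts G <= a :: w} /\ walk_length a w <= 2 * tree_length p G.
Proof.
move=> simpG [_ connG] aG.
(* [F] collects the edges already doubled. Since at most n vertices can be visited, the case m = n +
   1 forces the second alternative. *)
suff H m : exists w (F : {set 'I_n * 'I_n}),
    [/\ F \subset edges G,
        forall e, e \in F -> e.1 \in a :: w /\ e.2 \in a :: w,
        {subset a :: w <= verts G},
        walk_length a w <= 2 * \sum_(e in F) edist (p e.1) (p e.2) &
        (m <= #|[set x in a :: w]|)%N \/ {subset verts G <= a :: w}].
  have [w [F [FG _ _ wF [h|h]]]] := H n.+1.
    by have := leq_trans h (max_card _); rewrite card_ord ltnn.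
  exists w; split=> //; apply: le_trans wF _; rewrite ler_wpM2l //.
  rewrite /tree_length [leRHS](big_setID F) /= (setIidPr FG) lerDl.
  by apply: sumr_ge0 => e _; apply: edist_ge0.
elim: m => [|m [w [F [FG Fw wG wF [h|h]]]]].
- exists [::], set0; split=> //; first exact: sub0set.
  + by move=> e; rewrite inE.
  + by move=> x; rewrite inE => /eqP->.
  + by rewrite big_set0 mulr0.
  + by left.
- have [sub|/subsetPn[z zG zw]] := boolP (verts G \subset a :: w).
    by exists w, F; split=> //; right; apply/subsetP.
  have [u [v [uw vw uv]]] : exists u v, [/\ u \in a :: w, v \notin a :: w & adj G u v].
    have /connectP[q] := connG _ _ aG zG.
    suff gen x : x \in a :: w -> path (adj G) x q -> z = last x q ->
        exists u v, [/\ u \in a :: w, v \notin a :: w & adj G u v].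
      by apply: gen; exact: mem_head.
    elim: q x => [|y q IH] x xw /=; first by move=> _ e; rewrite e xw in zw.
    case/andP=> xy yq ez; have [yw|yw] := boolP (y \in a :: w).
      exact: (IH y).
    by exists x, y.
  have vG : v \in verts G by case/orP: uv => /simpG[].
  have [e [eG euv eV]] : exists e, [/\ e \in edges G,
      dist e.1 e.2 = dist u v & (e = (u, v) \/ e = (v, u))].
    case/orP: uv => uvG; [exists (u, v)|exists (v, u)]; split=> //; try by [left|right].
    exact: edistC.
  have eF : e \notin F.
    by apply: contra vw => /Fw[]; case: eV => ->.
  have [w1 [w2 [ew lastu]]] : exists w1 w2, w = w1 ++ w2 /\ last a w1 = u.
    by case/splitPl: (uw) => w1 w2 ew; exists w1, w2.
  have aw : a :: w1 ++ v :: u :: w2 =i v :: a :: w.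
    move=> x; rewrite ew !(inE, mem_cat); have [->|_] := eqVneq x u.
      by move: uw; rewrite ew !(inE, mem_cat) !orbT => ->; rewrite orbT.
    by case: (x == v); case: (x == a); case: (x \in w1).
  exists (w1 ++ v :: u :: w2), (e |: F); split.
  + by rewrite subUset sub1set eG.
  + move=> e'; rewrite in_setU1 !aw !(in_cons v) => /predU1P[->|/Fw[-> ->]].
      by case: eV => -> /=; rewrite uw eqxx orbT.
    by rewrite !orbT.
  + by move=> x; rewrite aw inE => /predU1P[->|/wG].
  + rewrite big_setU1 //= walk_length_cat lastu /= mulrDr.
    have : walk_length a w = walk_length a w1 + walk_length u w2.
      by rewrite ew walk_length_cat lastu.
    rewrite /dist in euv; rewrite euv (edistC (p v)); lra.
  + left; have -> : [set x in a :: w1 ++ v :: u :: w2] = v |: [set x in a :: w].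
      by apply/setP => x; rewrite !inE -[_ || _]/(x \in a :: _) aw !inE.
    by rewrite cardsU1 inE vw ltnS.
- by exists w, F; split=> //; right.
Qed.

End Walks.

(** * Trees built by nearest-neighbour insertion *)

Section Insertion.
Variables (R : realType) (n : nat) (p : 'I_n -> R * R).
Let dist (i j : 'I_n) : R := edist (p i) (p j).

Definition ord_edge (x y : 'I_n) : 'I_n * 'I_n := if (y < x)%N then (y, x) else (x, y).

(* The vertices, the edges and the total length, in the order of insertion. *)
Inductive greedy_tree : seq 'I_n -> seq ('I_n * 'I_n) -> R -> Prop :=
  | greedy_nil : greedy_tree [::] [::] 0
  | greedy_one y : greedy_tree [:: y] [::] 0
  | greedy_rcons v E c x y :
      greedy_tree v E c -> x \in v -> y \notin v ->
      (forall z, z \in v -> edist (p y) (p x) <= edist (p y) (p z)) ->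
      greedy_tree (rcons v y) (rcons E (ord_edge x y)) (c + edist (p y) (p x)).

Definition graph_of (v : seq 'I_n) (E : seq ('I_n * 'I_n)) : graph n :=
  Graph [set x in v] [set e in E].

Lemma greedy_tree_uniq v E c : greedy_tree v E c -> uniq v.
Proof. by elim=> // {}v {}E {}c x y _ uv _ yv _; rewrite rcons_uniq yv. Qed.

Lemma greedy_tree_nil E c : greedy_tree [::] E c -> E = [::] /\ c = 0.
Proof. by move ev : [::] => v T; case: T ev => // {}v {}E {}c x y _ _ _ _; case: v. Qed.

Lemma greedy_tree_edges v E c : greedy_tree v E c ->
  forall e, e \in E -> [/\ (e.1 < e.2)%N, e.1 \in v & e.2 \in v].
Proof.
elim=> // {}v {}E {}c x y _ IH xv yv _ e.
rewrite mem_rcons inE => /predU1P[->|/IH[e1 e2 e3]]; last first.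
  by rewrite !mem_rcons !inE e2 e3 !orbT.
rewrite /ord_edge; have xy : x <> y :> nat by move/val_inj=> exy; rewrite exy (negbTE yv) in xv.
by case: ifP => yx; split=> //=; rewrite ?mem_rcons ?inE ?xv ?eqxx ?orbT //; lia.
Qed.

Lemma greedy_tree_uniq_edges v E c : greedy_tree v E c -> uniq E.
Proof.
elim=> // {}v {}E {}c x y T uE xv yv _; rewrite rcons_uniq uE andbT.
apply: contra yv => /(greedy_tree_edges T)[_].
by rewrite /ord_edge; case: ifP.
Qed.

Lemma greedy_tree_length v E c : greedy_tree v E c ->
  tree_length p (graph_of v E) = c.
Proof.
move=> T; rewrite /tree_length /=.
transitivity (\sum_(e <- E) dist e.1 e.2).
  rewrite big_uniq ?(greedy_tree_uniq_edges T) //.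
  by apply: eq_bigl => e; rewrite inE.
elim: T => [||{}v {}E {}c x y _ <- _ _ _]; rewrite ?big_nil //.
rewrite -cats1 big_cat big_seq1; congr (_ + _).
by rewrite /ord_edge; case: ifP => //= _; apply: edistC.
Qed.

Lemma adj_graph_of v E i j : adj (graph_of v E) i j = ((i, j) \in E) || ((j, i) \in E).
Proof. by rewrite /adj /= !inE. Qed.

Lemma adjC (G : graph n) : symmetric (adj G).
Proof. by move=> i j; rewrite /adj orbC. Qed.

Lemma adj_rcons v E x y i j :
  adj (graph_of (rcons v y) (rcons E (ord_edge x y))) i j =
  [|| adj (graph_of v E) i j, (i == x) && (j == y) | (i == y) && (j == x)].
Proof.
rewrite !adj_graph_of !mem_rcons !inE /ord_edge.
by case: ifP => _; rewrite !xpair_eqE; case: (_ \in E); case: (_ \in E);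
  case: (i == x); case: (i == y); case: (j == x); case: (j == y).
Qed.

Lemma greedy_tree_connected v E c : greedy_tree v E c ->
  {in v &, forall i j, connect (adj (graph_of v E)) i j}.
Proof.
elim=> [i|y i j|{}v {}E {}c x y T IH xv yv _].
- by rewrite in_nil.
- by rewrite !inE => /eqP-> /eqP->.
set G := graph_of (rcons v y) _.
have sub : subrel (connect (adj (graph_of v E))) (connect (adj G)).
  by apply: connect_sub => i j ij; apply: connect1; rewrite adj_rcons ij.
have symG : connect_sym (adj G) by apply: sym_connect_sym; exact: adjC.
have xy : connect (adj G) x y by apply: connect1; rewrite adj_rcons !eqxx !orbT.
have toy i : i \in rcons v y -> connect (adj G) i y.
  rewrite mem_rcons inE => /predU1P[->|iv]; first exact: connect0.
  by apply: connect_trans xy; apply: sub; exact: IH.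
by move=> i j /toy iy /toy jy; apply: connect_trans iy _; rewrite symG.
Qed.

(* A cycle cannot visit the last vertex, which is a leaf. *)
Lemma greedy_tree_acyclic v E c : greedy_tree v E c -> acyclic_graph (graph_of v E).
Proof.
elim=> [|y|{}v {}E {}c x y T IH xv yv _] q sq uq.
- by case: q sq uq => [|a [|b q]] // _ /andP[+ _]; rewrite /= adj_graph_of.
- by case: q sq uq => [|a [|b q]] // _ /andP[+ _]; rewrite /= adj_graph_of.
have adjE i j : adj (graph_of v E) i j -> i \in v /\ j \in v.
  by rewrite adj_graph_of => /orP[] /(greedy_tree_edges T)[].
have adjy z : adj (graph_of (rcons v y) (rcons E (ord_edge x y))) y z -> z = x.
  rewrite adj_rcons => /or3P[/adjE[]|/andP[/eqP yx /eqP->]|/andP[_ /eqP //]] //.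
  by rewrite (negbTE yv).
have [yq|yq] := boolP (y \in q); last first.
  apply: (IH q sq); case/andP: uq => cq uq; rewrite /ucycle uq andbT.
  apply: (sub_in_cycle (P := [pred z | z != y])) cq; last first.
    by apply/allP => z zq /=; apply: contraNneq yq => <-.
  move=> i j /= /negbTE iy /negbTE jy; rewrite adj_rcons.
  by rewrite iy jy andbF orbF.
(* Rotated to start at [y], the cycle has a second and a last vertex that are both the only
   neighbour [x] of [y], so it repeats a vertex. *)
have [i q' eq'] := rot_to yq.
move: uq sq; rewrite -(rot_ucycle i) -(size_rot i) eq'.
case: q' {eq'} => [|z1 [|z2 q']] //=.
rewrite /ucycle /= rcons_path => /andP[/and3P[/adjy-> _ /andP[_]]].
rewrite adjC => /adjy <- /and3P[_ + _] _.
by rewrite mem_last.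
Qed.

Lemma greedy_tree_is_tree v E c : greedy_tree v E c -> v != [::] ->
  is_tree (graph_of v E).
Proof.
move=> T v0; split; last exact: greedy_tree_acyclic T.
  by move=> i j; rewrite inE => /(greedy_tree_edges T)[/= ij iv jv]; split; rewrite /= ?inE.
split; last by move=> i j; rewrite !inE; apply: greedy_tree_connected T _ _.
by case: v v0 {T} => // x v _; apply/set0Pn; exists x; rewrite !inE eqxx.
Qed.

(** Here [f z] is the cost paid when [z] entered, 0 for the first vertex. Of two vertices, the later
    one could have been joined to the earlier one, so its cost is at most their distance: this is
    the separation that packing consumes. *)
Lemma greedy_tree_cost v E c : greedy_tree v E c -> exists f : 'I_n -> R,
  [/\ forall z, 0 <= f z,
      forall z, z \in v -> f z = 0 \/ exists2 u, u \in v & f z <= dist z u,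
      {in v &, forall z u, z != u -> f z <= dist z u \/ f u <= dist z u} &
      c = \sum_(z <- v) f z].
Proof.
elim=> [|y|{}v {}E {}c x y T [f [f0 fd fs ->]] xv yv xmin].
- by exists (fun=> 0); split=> //; rewrite big_nil.
- exists (fun=> 0); split=> [//|z _|z u _ _ _|]; rewrite ?big_seq1 //; first by left.
  by left; apply: edist_ge0.
have vy z : z \in v -> z == y = false.
  by move=> zv; apply: contraNF yv => /eqP<-.
exists (fun z => if z == y then dist y x else f z); split.
- by move=> z; case: ifP => // _; apply: edist_ge0.
- move=> z; rewrite mem_rcons inE => /predU1P[->|zv].
    by rewrite eqxx; right; exists x; rewrite // mem_rcons inE xv orbT.
  rewrite vy //; case: (fd z zv) => [|[u uv zu]]; [by left | right].
  by exists u; rewrite // mem_rcons inE uv orbT.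
- move=> z u; rewrite !mem_rcons !inE => /predU1P[->|zv] /predU1P[->|uv] zu.
  + by rewrite eqxx in zu.
  + by rewrite eqxx; left; apply: xmin.
  + by rewrite eqxx /dist (edistC (p z)); right; apply: xmin.
  + by rewrite !vy //; apply: fs.
- rewrite -cats1 big_cat big_seq1 eqxx; congr (_ + _).
  by rewrite !big_seq; apply: eq_bigr => z zv; rewrite vy.
Qed.

End Insertion.

(** * Greedy covering *)

(* Greedy choice for covering with outliers: the ball of radius 3r around x
   swallows any ball of radius r meeting it in a new point; if there is none,
   the new points near x replace those near c. *)
Lemma greedy_cover_step (R : realType) (T : finType) (p : T -> R * R) (r : R)
    (U O v v' : {set T}) (x c : T) (J : seq T) (k : nat) :
    0 <= r ->
    let cov J := [set y in O | has (fun c => edist (p c) (p y) <= r) J] in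
    let news c := [set y in U | (y \notin v) && (edist (p c) (p y) <= r)] in
    O \subset U -> (#|news c| <= #|news x|)%N -> v \subset v' ->
    (forall y, y \in U -> edist (p x) (p y) <= 3 * r -> y \in v') ->
    (k <= #|v :|: cov (c :: J)|)%N ->
  exists J', size J' = size J /\ (k <= #|v' :|: cov J'|)%N.
Proof.
move=> r0 cov news OU cx vv' xv' kJ.
have newsx y : y \in news x -> y \in v'.
  rewrite inE => /and3P[yU _ xy]; apply: xv' => //; apply: le_trans xy _.
  by lra.
case: (boolP [exists c' in c :: J, [exists y in O, (y \in news x) && (edist (p c') (p y) <= r)]]).
  case/exists_inP=> c' c'J /exists_inP[y0 y0O /andP[]].
  rewrite inE => /and3P[_ _ xy0] c'y0.
  exists (rem c' (c :: J)); split; first by rewrite size_rem.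
  apply: leq_trans kJ _; apply: subset_leq_card; apply/subsetP => y.
  rewrite !in_setU => /orP[/(subsetP vv')-> //|].
  rewrite [y \in cov (c :: J)]inE => /andP[yO /hasP[c2 c2J c2y]].
  have [ec|nc] := eqVneq c2 c'.
    (* The points [y] and [y0] share the ball of [c'], and [y0] is within r of [x]: three steps of
       length r lead from [x] to [y]. *)
    rewrite xv' //; first exact: (subsetP OU).
    have h1 := edist_triangle (p c') (p x) (p y).
    have h2 := edist_triangle (p y0) (p x) (p c').
    rewrite (edistC (p y0)) -ec in h2; rewrite -ec in c'y0 h1; lra.
  apply/orP; right; rewrite inE yO /=; apply/hasP; exists c2 => //.
  by move: c2J; rewrite (perm_mem (perm_to_rem c'J)) inE (negbTE nc).
move=> none; exists J; split=> //.
have disj : [disjoint v :|: cov J & news x].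
  rewrite disjoint_subset; apply/subsetP => y; rewrite !inE.
  case/orP=> [->|/andP[yO /hasP[c2 c2J c2y]]]; first by rewrite andbF.
  apply: contra none => yx; apply/exists_inP; exists c2; first by rewrite inE c2J orbT.
  by apply/exists_inP; exists y; rewrite // inE yx.
apply: leq_trans kJ _.
apply: (@leq_trans #|(v :|: cov J) :|: news c|).
  apply/subset_leq_card/subsetP => y; rewrite !inE => /orP[->//|].
  case/andP=> yO /orP[cy|yJ]; last by apply/orP; left; rewrite yO; apply/orP; right.
  by rewrite (subsetP OU _ yO) cy; case: (y \in v); rewrite ?orbT.
apply: leq_trans (leq_card_setU _ _) _.
apply: (@leq_trans #|(v :|: cov J) :|: news x|).
  by rewrite [leqRHS]cardsU (disjoint_setI0 disj) cards0 subn0 leq_add2l.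
apply/subset_leq_card/subsetP => y; rewrite !in_setU => /orP[/orP[]|/newsx->] //.
  by move/(subsetP vv')->.
by move=> yJ; apply/orP; right.
Qed.

(** * The approximation ratio *)

Section Ratio.
Variables (R : realType) (n : nat) (p : 'I_n -> R * R) (k : nat).
Let dist (i j : 'I_n) : R := edist (p i) (p j).

Definition scale (s j : 'I_n) : R := dist s j / Num.sqrt k%:R.

(* What the program guarantees for the candidate [v] built from the guess (s, j):
   it refers to an optimal tree only through a cover of its vertices. *)
Definition covers_well (s j : 'I_n) (v : seq 'I_n) : Prop :=
  forall (O : {set 'I_n}) (J : seq 'I_n),
    (size J <= n)%N -> (k <= #|O|)%N -> (forall y, y \in O -> dist s y <= dist s j) ->
    (forall y, y \in O -> exists2 c, c \in J & dist c y <= scale s j) ->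
  exists xs : seq 'I_n,
    [/\ (size xs <= size J)%N,
        forall y, y \in v -> dist s y <= dist s j &
        forall y, y \in v -> exists2 x, x \in xs & dist x y <= 3 * scale s j].

Lemma optimal_cover (T0 : graph n) :
    simple_graph T0 -> connected_graph T0 ->
  exists s j J, [/\ (size J <= n)%N,
    forall y, y \in verts T0 -> dist s y <= dist s j,
    forall y, y \in verts T0 -> exists2 c, c \in J & dist c y <= scale s j,
    (size J)%:R * scale s j <= 2 * tree_length p T0 + scale s j &
    dist s j <= 2 * tree_length p T0].
Proof.
move=> simpT connT; have [/set0Pn[s sT] _] := connT.
have [w [wT wL]] := walk_exists p simpT connT sT.
case: (@Order.TotalTheory.arg_maxP _ _ _ s (fun y => y \in verts T0) (dist s) sT) => j jT jmax.
have r0 : 0 <= scale s j by rewrite divr_ge0 ?edist_ge0 ?sqrtr_ge0.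
have [J [JT JL]] := walk_cover p s w r0.
(* Removing repeated centres keeps their number within n, the number of rounds that the program
   runs. *)
exists s, j, (undup (s :: J)); split.
- by rewrite -(card_uniqP (undup_uniq (s :: J))) (leq_trans (max_card _)) ?card_ord.
- by move=> y /jmax.
- by move=> y /wT /JT[c cJ cy]; exists c; rewrite ?mem_undup.
- apply: (@le_trans _ _ ((size (s :: J))%:R * scale s j)).
    by rewrite ler_wpM2r // ler_nat size_undup.
  by rewrite /= -natr1 mulrDl mul1r; lra.
- by apply: le_trans wL; apply: dist_le_walk_length; exact: wT.
Qed.

Lemma candidate_length (T0 : graph n) (s j : 'I_n) (J : seq 'I_n)
    (v : seq 'I_n) (E : seq ('I_n * 'I_n)) (c : R) :
    (0 < k)%N -> #|verts T0| = k -> (size J <= n)%N ->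
    (forall y, y \in verts T0 -> dist s y <= dist s j) ->
    (forall y, y \in verts T0 -> exists2 c, c \in J & dist c y <= scale s j) ->
    (size J)%:R * scale s j <= 2 * tree_length p T0 + scale s j ->
    dist s j <= 2 * tree_length p T0 ->
    greedy_tree p v E c -> size v = k -> covers_well s j v ->
  c <= 756 * k%:R `^ 4^-1 * tree_length p T0.
Proof.
move=> k0 kT Jn sT JT JL dL T vk vcov.
have [|xs [xsJ vs vxs]] := vcov (verts T0) J Jn _ sT JT; first by rewrite kT.
have [f [f0 fd fs ->]] := greedy_tree_cost T.
set d := dist s j in sT dL vs *; set r := scale s j in JT JL vxs *.
set L := tree_length p T0 in JL dL *.
have d0 : 0 <= d by exact: edist_ge0.
have L0 : 0 <= L by lra.
have k1 : 1 <= k%:R :> R by rewrite ler1n.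
set K : R := Num.sqrt k%:R.
have K1 : 1 <= K by rewrite -sqrtr1 ler_wsqrtr.
have dr : d = r * K by rewrite /r /scale divfK // gt_eqF // (lt_le_trans ltr01).
have r0 : 0 <= r by rewrite divr_ge0 // sqrtr_ge0.
have uv := greedy_tree_uniq T.
have kV : #|[set x in v]| = k by rewrite cardsE; move/card_uniqP: uv => ->.
have sumf : \sum_(z <- v) f z = \sum_(z in [set x in v]) f z.
  by rewrite big_uniq //; apply: eq_bigl => z; rewrite inE.
have cost : \sum_(z <- v) f z <= 252 * d * Num.sqrt (size xs)%:R.
  rewrite sumf; apply: (@insertion_cost _ _ p _ f (p s) xs d r) => //.
  - by rewrite kV.
  - by move=> y; rewrite inE; apply: vs.
  - by move=> y; rewrite inE; apply: vxs.
  - move=> y; rewrite inE f0 /= => yv; case: (fd y yv) => [->|[u uv' yu]]; first lra.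
    apply: le_trans yu _; apply: le_trans (edist_triangle (p s) _ _) _.
    by rewrite edistC; have := vs y yv; have := vs u uv'; rewrite /dist; lra.
  - by move=> y z; rewrite !inE; apply: fs.
apply: le_trans cost _.
set q : R := k%:R `^ 4^-1.
have qq : q ^+ 2 = K.
  rewrite /q -powR_mulrn ?powR_ge0 // -powRrM /K -powR12_sqrt //.
  by congr (_ `^ _); lra.
have q0 : 0 <= q by exact: powR_ge0.
(* 756 = 252 * 3. With m the size of [xs], d = r K and d <= 2 L give d ^ 2 m = d K (m r) <= 2 d L K
   + d ^ 2 <= 8 L ^ 2 K, because K >= 1; the square of 3 q L is 9 L ^ 2 K. *)
suff : d * Num.sqrt (size xs)%:R <= 3 * (q * L) by lra.
rewrite -(@ler_pXn2r _ 2) ?nnegrE ?mulr_ge0 ?sqrtr_ge0 //.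
rewrite !exprMn (sqr_sqrtr (ler0n R (size xs))) qq.
have xsr : (size xs)%:R * r <= 2 * L + r.
  by apply: le_trans JL; rewrite ler_wpM2r // ler_nat.
have -> : d ^+ 2 * (size xs)%:R = d * K * ((size xs)%:R * r) by rewrite expr2 {2}dr; ring.
apply: (@le_trans _ _ (d * K * (2 * L + r))).
  by rewrite ler_wpM2l // mulr_ge0 //; lra.
have -> : d * K * (2 * L + r) = 2 * d * L * K + d ^+ 2 by rewrite expr2 {4}dr; ring.
have h1 : d ^+ 2 <= 4 * L ^+ 2 by rewrite !expr2; nra.
have h2 : 2 * d * L * K <= 4 * L ^+ 2 * K.
  by rewrite ler_wpM2r //; [lra | rewrite expr2; nra].
have h3 : 4 * L ^+ 2 <= 4 * L ^+ 2 * K by rewrite ler_peMr // mulr_ge0 ?sqr_ge0.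
have h4 : 0 <= L ^+ 2 * K by rewrite mulr_ge0 ?sqr_ge0 //; lra.
lra.
Qed.

End Ratio.

(** * Programs whose only loops are [for c < n] *)

Inductive prog : Type :=
  | PSkip
  | PN of nat & nexp & nexp
  | PR of nat & nexp & rexp
  | PSeq of prog & prog
  | PIf of bexp & prog & prog
  | PFor of nat & prog.

Definition loop_test (c : nat) : bexp :=
  BLtN (NCell c (NConst 0)) (NCell 0 (NConst 0)).

Definition loop_incr (c : nat) : cmd :=
  NStore c (NConst 0) (NAdd (NCell c (NConst 0)) (NConst 1)).

Fixpoint compile (c : prog) : cmd :=
  match c with
  | PSkip => Skip
  | PN a i e => NStore a i e
  | PR a i e => RStore a i e
  | PSeq c1 c2 => Seq (compile c1) (compile c2)
  | PIf b c1 c2 => If b (compile c1) (compile c2)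
  | PFor a c1 => Seq (NStore a (NConst 0) (NConst 0))
      (While (loop_test a) (Seq (compile c1) (loop_incr a)))
  end.

Fixpoint nwrites (c : prog) : seq nat :=
  match c with
  | PSkip | PR _ _ _ => [::]
  | PN a _ _ => [:: a]
  | PSeq c1 c2 | PIf _ c1 c2 => nwrites c1 ++ nwrites c2
  | PFor a c1 => a :: nwrites c1
  end.

Fixpoint rwrites (c : prog) : seq nat :=
  match c with
  | PSkip | PN _ _ _ => [::]
  | PR a _ _ => [:: a]
  | PSeq c1 c2 | PIf _ c1 c2 => rwrites c1 ++ rwrites c2
  | PFor _ c1 => rwrites c1
  end.

Fixpoint wf (c : prog) : bool :=
  match c with
  | PSkip | PN _ _ _ | PR _ _ _ => true
  | PSeq c1 c2 | PIf _ c1 c2 => wf c1 && wf c2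
  | PFor a c1 => [&& a != 0%N, 0%N \notin nwrites c1, a \notin nwrites c1 & wf c1]
  end.

(** In a loop, the 2 per iteration are the successful test and the increment; the final 2 are the
    initialisation and the failing test. *)
Fixpoint ptime (c : prog) (n : nat) : nat :=
  match c with
  | PSkip | PN _ _ _ | PR _ _ _ => 1
  | PSeq c1 c2 => ptime c1 n + ptime c2 n
  | PIf _ c1 c2 => (ptime c1 n + ptime c2 n).+1
  | PFor _ c1 => n * (ptime c1 n + 2) + 2
  end.

Lemma ptime_poly (c : prog) :
  exists a b : nat, forall n, (0 < n)%N -> (ptime c n <= a * n ^ b)%N.
Proof.
have merge c1 c2 : (exists a b, forall n, (0 < n)%N -> (ptime c1 n <= a * n ^ b)%N) ->
    (exists a b, forall n, (0 < n)%N -> (ptime c2 n <= a * n ^ b)%N) ->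
    exists a b, forall n, (0 < n)%N -> ((ptime c1 n + ptime c2 n).+1 <= a * n ^ b)%N.
  move=> [a1 [b1 h1]] [a2 [b2 h2]]; exists (a1 + a2 + 1)%N, (b1 + b2)%N => n n0.
  have := h1 n n0; have := h2 n n0.
  rewrite expnD; move: (expn_gt0 n b1) (expn_gt0 n b2); rewrite n0 /=.
  by move: (n ^ b1)%N (n ^ b2)%N; nia.
elim: c => [|a i e|a i e|c1 h1 c2 h2|b c1 h1 c2 h2|x c1 [a [b h]]] /=.
- by exists 1%N, 0%N.
- by exists 1%N, 0%N.
- by exists 1%N, 0%N.
- by have [a [b h]] := merge _ _ h1 h2; exists a, b => n /h /ltnW.
- exact: merge.
exists (a + 4)%N, b.+1 => n n0; have := h n n0.
rewrite expnS; move: (expn_gt0 n b); rewrite n0 /=.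
by move: (n ^ b)%N (ptime c1 n); nia.
Qed.

(** * Denotational semantics of loop programs and its agreement with execution *)

Section Denotation.
Variable R : realType.
Implicit Types s : state R.

Definition setN s a i v := State (upd (nmem s) a i v) (rmem s).

(** Every program is total, as the number of iterations is read before the loop starts. The next
    counter is computed from its value before the body, which matches the compiled increment as soon
    as the body does not write the counter. *)
Fixpoint den (c : prog) s : state R :=
  match c with
  | PSkip => s
  | PN a i e => State (upd (nmem s) a (neval s i) (neval s e)) (rmem s)
  | PR a i e => State (nmem s) (upd (rmem s) a (neval s i) (reval s e))
  | PSeq c1 c2 => den c2 (den c1 s)
  | PIf b c1 c2 => if beval s b then den c1 s else den c2 s
  | PFor a c1 =>
      iter (nmem s 0 0) (fun s' => setN (den c1 s') a 0 (nmem s' a 0).+1)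
           (setN s a 0 0)
  end.

Lemma updE (V : Type) (m : nat -> nat -> V) a i v b j :
  upd m a i v b j = if (b == a) && (j == i) then v else m b j.
Proof. by []. Qed.

Lemma upd_neq (V : Type) (m : nat -> nat -> V) a i v b j :
  b != a -> upd m a i v b j = m b j.
Proof. by rewrite /upd => /negbTE ->. Qed.

Lemma den_nframe c s a i : a \notin nwrites c -> nmem (den c s) a i = nmem s a i.
Proof.
elim: c s => //= [b j e|c1 h1 c2 h2|b c1 h1 c2 h2|b c1 h] s.
- by rewrite inE => ab; rewrite upd_neq.
- by rewrite mem_cat negb_or => /andP[/h1 e1 /h2 e2]; rewrite e2 e1.
- by rewrite mem_cat negb_or => /andP[/h1 e1 /h2 e2]; case: ifP.
- rewrite inE negb_or => /andP[ab /h e].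
  by elim: (nmem s 0 0) => /= [|m IH]; rewrite upd_neq ?e.
Qed.

Lemma den_rframe c s a i : a \notin rwrites c -> rmem (den c s) a i = rmem s a i.
Proof.
elim: c s => //= [b j e|c1 h1 c2 h2|b c1 h1 c2 h2|b c1 h] s.
- by rewrite inE => ab; rewrite upd_neq.
- by rewrite mem_cat negb_or => /andP[/h1 e1 /h2 e2]; rewrite e2 e1.
- by rewrite mem_cat negb_or => /andP[/h1 e1 /h2 e2]; case: ifP.
- by move=> /h e; elim: (nmem s 0 0) => /= [|m IH] //; rewrite e.
Qed.

Lemma exec_den c s n : wf c -> 0%N \notin nwrites c -> nmem s 0 0 = n ->
  exists2 t, exec (compile c) s t (den c s) & (t <= ptime c n)%N.
Proof.
elim: c s => /= [|a i e|a i e|c1 h1 c2 h2|b c1 h1 c2 h2|a c h] s.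
- by exists 1%N => //; constructor.
- by exists 1%N => //; constructor.
- by exists 1%N => //; constructor.
- rewrite mem_cat negb_or => /andP[w1 w2] /andP[n1 n2] en.
  have [t1 e1 l1] := h1 s w1 n1 en.
  have [|t2 e2 l2] := h2 (den c1 s) w2 n2; first by rewrite den_nframe.
  by exists (t1 + t2)%N; [exact: exec_seq e1 e2 | rewrite leq_add].
- rewrite mem_cat negb_or => /andP[w1 w2] /andP[n1 n2] en.
  case: ifP => bs.
    have [t1 e1 l1] := h1 s w1 n1 en; exists t1.+1; last by lia.
    exact: exec_if_true.
  have [t2 e2 l2] := h2 s w2 n2 en; exists t2.+1; last by lia.
  by apply: exec_if_false; rewrite ?bs.
case/and4P=> a0 n0 na wc _ en; rewrite en.
set F := fun s' : state R => _; set W := While _ _.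
(* Induction on the number [m] of iterations left, the counter being at n - m. *)
suff H m s' : (m <= n)%N -> nmem s' 0 0 = n -> nmem s' a 0 = (n - m)%N ->
    exists2 t, exec W s' t (iter m F s') & (t <= m * (ptime c n + 2) + 1)%N.
  have [||t et lt] := H n (setN s a 0 0) (leqnn n).
  - by rewrite /= updE eq_sym (negbTE a0).
  - by rewrite /= updE !eqxx subnn.
  exists (1 + t)%N; last by lia.
  by apply: exec_seq et; constructor.
elim: m s' => [|m IH] s' le_mn en' ea.
  by exists 1%N => //; apply: exec_while_false; rewrite /= ea en' subn0 ltnn.
have [t1 e1 l1] := h s' wc n0 en'.
have eF : F s' = setN (den c s') a 0 (nmem s' a 0 + 1) by rewrite addn1.
have [|||t2 e2 l2] := IH (F s').
- exact: ltnW.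
- by rewrite eF /= updE eq_sym (negbTE a0) den_nframe.
- by rewrite eF /= updE !eqxx /=; lia.
rewrite iterSr; exists ((t1 + 1) + t2).+1; last by lia.
apply: exec_while_true e2; first by rewrite /= ea en'; lia.
apply: exec_seq e1 _; rewrite eF -(den_nframe s' 0 na); constructor.
Qed.

Lemma den_for (I : nat -> state R -> Prop) n a c s :
    wf (PFor a c) -> nmem s 0 0 = n -> I 0%N (setN s a 0 0) ->
    (forall i s', (i < n)%N -> nmem s' a 0 = i -> nmem s' 0 0 = n -> I i s' ->
       I i.+1 (setN (den c s') a 0 i.+1)) ->
  I n (den (PFor a c) s).
Proof.
move=> /and4P[a0 n0 na _] en I0 IS; rewrite /= en.
set F := fun s' : state R => _.
suff: forall m, (m <= n)%N -> let s' := iter m F (setN s a 0 0) in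
    [/\ nmem s' 0 0 = n, nmem s' a 0 = m & I m s'] by move=> /(_ n (leqnn n)) [].
elim=> [|m IH] lt_mn /=.
  by rewrite !updE /= !eqxx andbT eq_sym (negbTE a0).
have {IH} := IH (ltnW lt_mn); set s1 := iter m F _ => -[e0 ea Im].
rewrite !updE /= !eqxx andbT eq_sym (negbTE a0) den_nframe // ea; split=> //.
by rewrite /F ea; apply: IS.
Qed.

End Denotation.

(** * The program *)

Definition cell (a : nat) : nexp := NCell a (NConst 0).
Definition rcell (a : nat) : rexp := RCell a (NConst 0).
Definition setn (a : nat) (e : nexp) : prog := PN a (NConst 0) e.
Definition setr (a : nat) (e : rexp) : prog := PR a (NConst 0) e.
Definition when (b : bexp) (c : prog) : prog := PIf b c PSkip.
Definition ble (e1 e2 : rexp) : bexp := BNot (BLtR e2 e1).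

Definition rsqr (e : rexp) : rexp := RMul e e.
Definition rdist (i j : nexp) : rexp :=
  RSqrt (RAdd (rsqr (RSub (RCell 0 i) (RCell 0 j)))
              (rsqr (RSub (RCell 1 i) (RCell 1 j)))).

(* Natural arrays: 7, 8 the guessed centre and radius point; 10, 11 the number
   and the list of the vertices of the candidate; 13, 14 its edges; 15 the
   characteristic function of its vertices; 16-19 loop counters; 20, 21 current
   and best score; 22 the point of best score; 23 the nearest vertex.
   Real arrays: 2 the radius d; 3 the scale r; 4 the length of the candidate;
   5 the distance to the nearest vertex; 6 the length of the best candidate. *)

Definition nearest : prog :=
  PFor 19 (when
    (BAnd (BLtN (cell 19) (cell 10))
       (BNot (BAnd (BNot (BLtN (cell 19) (NConst 1)))
                   (BNot (BLtR (rdist (cell 18) (NCell 11 (cell 19))) (rcell 5))))))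
    (PSeq (setr 5 (rdist (cell 18) (NCell 11 (cell 19))))
          (setn 23 (NCell 11 (cell 19))))).

(** [link] runs before [push]: array 10 still counts the m old vertices, whose m - 1 edges occupy
    the indices below m - 1. *)
Definition last_edge : nexp := NSub (cell 10) (NConst 1).

Definition link : prog :=
  when (BLtN (NConst 0) (cell 10))
    (PSeq (PIf (BLtN (cell 18) (cell 23))
             (PSeq (PN 13 last_edge (cell 18)) (PN 14 last_edge (cell 23)))
             (PSeq (PN 13 last_edge (cell 23)) (PN 14 last_edge (cell 18))))
          (setr 4 (RAdd (rcell 4) (rcell 5)))).

Definition push : prog :=
  PSeq (PN 11 (cell 10) (cell 18))
    (PSeq (PN 15 (cell 18) (NConst 1)) (setn 10 (NAdd (cell 10) (NConst 1)))).

Definition insert : prog :=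
  when (BAnd (BLtN (NCell 15 (cell 18)) (NConst 1)) (BLtN (cell 10) (cell 1)))
    (PSeq nearest (PSeq link push)).

Definition insert_all (b : bexp) : prog := PFor 18 (when b insert).

Definition in_disk : bexp := ble (rdist (cell 7) (cell 18)) (rcell 2).

Definition counts : bexp :=
  BAnd in_disk (BAnd (BLtN (NCell 15 (cell 18)) (NConst 1))
                     (ble (rdist (cell 17) (cell 18)) (rcell 3))).

Definition score_loop : prog :=
  PFor 18 (when counts (setn 20 (NAdd (cell 20) (NConst 1)))).

Definition score : prog := PSeq (setn 20 (NConst 0)) score_loop.

Definition pick_loop : prog :=
  PFor 17 (PSeq score
    (when (BLtN (cell 21) (cell 20))
       (PSeq (setn 21 (cell 20)) (setn 22 (cell 17))))).

Definition pick : prog :=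
  PSeq (setn 21 (NConst 0)) (PSeq (setn 22 (NConst 0)) pick_loop).

Definition near_pick : bexp :=
  BAnd in_disk
    (ble (rdist (cell 22) (cell 18)) (RMul (RNat (NConst 3)) (rcell 3))).

Definition rounds : prog := PFor 16 (PSeq pick (insert_all near_pick)).

Definition init : prog :=
  PSeq (setr 2 (rdist (cell 7) (cell 8)))
    (PSeq (setr 3 (RDiv (rcell 2) (RSqrt (RNat (cell 1)))))
       (PSeq (setr 4 (RNat (NConst 0))) (setn 10 (NConst 0)))).

Definition clear : prog := PFor 18 (PN 15 (cell 18) (NConst 0)).

Definition btrue : bexp := BLtN (NConst 0) (NConst 1).

(** The last pass tops the tree up to k vertices, so that even a useless guess yields an admissible
    candidate. *)
Definition build : prog :=
  PSeq init (PSeq clear (PSeq rounds (insert_all btrue))).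

Definition copy_arrays : prog :=
  PFor 19 (PSeq (PN 3 (cell 19) (NCell 11 (cell 19)))
    (PSeq (PN 5 (cell 19) (NCell 13 (cell 19))) (PN 6 (cell 19) (NCell 14 (cell 19))))).

(** A disjunction by De Morgan: the candidate is shorter, or the recorded length is negative. The
    latter is the sentinel -1 set by [main], meaning that nothing is recorded yet. *)
Definition better : bexp :=
  BNot (BAnd (BNot (BLtR (rcell 4) (rcell 6))) (BNot (BLtR (rcell 6) (RNat (NConst 0))))).

Definition record_best : prog :=
  PSeq (setr 6 (rcell 4))
    (PSeq (setn 2 (cell 1)) (setn 4 (NSub (cell 1) (NConst 1)))).

Definition keep_best : prog := when better (PSeq copy_arrays record_best).

Definition search : prog := PFor 7 (PFor 8 (PSeq build keep_best)).

Definition main : prog :=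
  PSeq (setr 6 (RSub (RNat (NConst 0)) (RNat (NConst 1))))
    search.


Lemma mkseq_upd (V : Type) (m : nat -> nat -> V) (a i : nat) (x : V) :
  mkseq (upd m a i x a) i.+1 = rcons (mkseq (m a) i) x.
Proof.
rewrite mkseqS updE !eqxx; congr rcons; apply/eq_in_map => t.
by rewrite mem_iota /= updE eqxx => /ltn_eqF ->.
Qed.

(** * Frame conditions: the arrays that a program preserves *)

Section Agreement.
Variable R : realType.
Implicit Types s : state R.

Definition agree (NA RA : seq nat) s s' : Prop :=
  (forall a i, a \in NA -> nmem s' a i = nmem s a i) /\
  (forall a i, a \in RA -> rmem s' a i = rmem s a i).

Lemma agree_trans NA RA s1 s2 s3 : agree NA RA s1 s2 -> agree NA RA s2 s3 ->
  agree NA RA s1 s3.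
Proof. by move=> [h1 h2] [h3 h4]; split=> a i ai; rewrite ?h3 ?h4 ?h1 ?h2. Qed.

Lemma agree_sub NA RA NA' RA' s1 s2 : agree NA RA s1 s2 ->
  all (mem NA) NA' -> all (mem RA) RA' -> agree NA' RA' s1 s2.
Proof.
move=> [h1 h2] /allP sN /allP sR; split=> a i ai; first by apply: h1; apply: sN.
by apply: h2; apply: sR.
Qed.

Lemma agree_den NA RA c s : all (fun a => a \notin nwrites c) NA ->
  all (fun a => a \notin rwrites c) RA -> agree NA RA s (den c s).
Proof.
by move=> /allP nN /allP nR; split=> a i ai; [apply: den_nframe; apply: nN |
  apply: den_rframe; apply: nR].
Qed.

Lemma agree_setN NA RA s a i v : a \notin NA -> agree NA RA s (setN s a i v).
Proof.
move=> aN; split=> // b j bN /=; rewrite upd_neq //.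
by apply: contraNneq aN => <-.
Qed.

End Agreement.

(** * Invariants and specifications of the program *)

Section Correctness.
Variables (R : realType) (n k : nat) (p : 'I_n -> R * R).
Hypotheses (k_gt0 : (0 < k)%N) (le_kn : (k <= n)%N).
Implicit Types (s : state R) (v : seq 'I_n) (E : seq ('I_n * 'I_n)) (c : R).

Record env s : Prop := Env {
  env_n : nmem s 0 0 = n;
  env_k : nmem s 1 0 = k;
  env_x : forall i : 'I_n, rmem s 0 i = (p i).1;
  env_y : forall i : 'I_n, rmem s 1 i = (p i).2 }.

Record rep v E c s : Prop := Rep {
  rep_size : nmem s 10 0 = size v;
  rep_verts : mkseq (nmem s 11) (size v) = map val v;
  rep_edges : mkseq (fun t => (nmem s 13 t, nmem s 14 t)) (size v).-1 =
    [seq (val e.1, val e.2) | e <- E];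
  rep_mem : forall y : 'I_n, nmem s 15 y = (y \in v);
  rep_cost : rmem s 4 0 = c }.

Lemma env_agree s s' : agree [:: 0; 1]%N [:: 0; 1]%N s s' -> env s -> env s'.
Proof.
by move=> [hN hR] [e1 e2 e3 e4]; split; move=> *; rewrite ?hN ?hR // ?inE.
Qed.

Lemma rep_agree v E c s s' : agree [:: 10; 11; 13; 14; 15]%N [:: 4%N] s s' ->
  rep v E c s -> rep v E c s'.
Proof.
move=> [hN hR] [e1 e2 e3 e4 e5]; split; rewrite ?hN ?hR //.
- by rewrite -e2; apply: eq_mkseq => t; rewrite hN.
- by rewrite -e3; apply: eq_mkseq => t; rewrite !hN.
- by move=> y; rewrite hN.
Qed.

Lemma rdistE s e1 e2 (i j : 'I_n) : env s -> neval s e1 = i -> neval s e2 = j ->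
  reval s (rdist e1 e2) = edist (p i) (p j).
Proof. by move=> h /= -> ->; rewrite !(env_x h) !(env_y h) -!expr2. Qed.

Lemma nth_rep v E c s (y : 'I_n) t : rep v E c s -> (t < size v)%N ->
  nmem s 11 t = nth y v t.
Proof.
move=> h tv; rewrite -[RHS]/(val _) -(nth_map y 0%N val) // -(rep_verts h).
by rewrite nth_mkseq.
Qed.

Lemma nearest_spec s v E c (y : 'I_n) :
    env s -> rep v E c s -> nmem s 18 0 = y -> (0 < size v <= n)%N ->
  exists x, [/\ x \in v, nmem (den nearest s) 23 0 = x,
    rmem (den nearest s) 5 0 = edist (p y) (p x) &
    forall z, z \in v -> edist (p y) (p x) <= edist (p y) (p z)].
Proof.
move=> es rs ys /andP[v0 vn].
pose I i s' := [/\ agree [:: 0; 1; 10; 11; 13; 14; 15; 18]%N [:: 0; 1; 4]%N s s' &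
  (0 < i)%N -> exists x, [/\ x \in take i v, nmem s' 23 0 = x,
    rmem s' 5 0 = edist (p y) (p x) &
    forall z, z \in take i v -> edist (p y) (p x) <= edist (p y) (p z)]].
suff [_] : I n (den nearest s).
  by rewrite take_oversize //; apply; apply: leq_trans vn.
apply: den_for => //; first exact: env_n es.
  by split=> //; apply: agree_setN.
move=> i s' lt_in ei _ [ag Ii]; split.
  apply: agree_trans ag (agree_trans (agree_den _ _ _) (agree_setN _ _ _ _ _)) => //.
have es' : env s' by apply: env_agree es; apply: agree_sub ag _ _.
have rs' : rep v E c s' by apply: rep_agree rs; apply: agree_sub ag _ _.
have ys' : nmem s' 18 0 = y by rewrite ag.1.
move=> _; rewrite /= ei (rep_size rs').
have [lt_iv|le_vi] := ltnP i (size v); last first.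
  rewrite /= !take_oversize ?leqW //.
  have := Ii (leq_trans v0 le_vi); rewrite take_oversize //.
have zE := nth_rep y rs' lt_iv; set z := nth y v i in zE.
have /= := @rdistE s' (cell 18) (NCell 11 (NConst i)) y z es' ys' zE; rewrite (take_nth y) // -/z /= => ->; rewrite zE.
(* At index 0 the test succeeds unconditionally, so the distance left in real array 5 by an earlier
   call does no harm. *)
have [->|i0] := posnP i.
  rewrite take0 /=; exists z; split; rewrite ?mem_head // => t.
  by rewrite inE => /eqP ->.
have [x [xv xN xR xmin]] := Ii i0; rewrite ltnS leqNgt i0 /= xR.
case: ltP => h /=.
  exists z; split; rewrite ?mem_rcons ?mem_head //.
  move=> t; rewrite mem_rcons inE => /predU1P[-> //|/xmin].
  by apply: le_trans; apply: ltW.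
exists x; split=> //; rewrite ?mem_rcons ?inE ?xv ?orbT //.
by move=> t; rewrite mem_rcons inE => /predU1P[-> //|/xmin].
Qed.

Lemma mkseq_upd2 (m m' : nat -> nat -> nat) (a b i x y : nat) :
    m' a =1 upd m a i x a -> m' b =1 upd m b i y b ->
  mkseq (fun t => (m' a t, m' b t)) i.+1 =
  rcons (mkseq (fun t => (m a t, m b t)) i) (x, y).
Proof.
move=> ha hb; rewrite mkseqS ha hb !updE !eqxx; congr rcons; apply/eq_in_map => t.
by rewrite mem_iota /= ha hb !updE !eqxx => /ltn_eqF ->.
Qed.

Lemma link_nil s E c : rep [::] E c s -> den link s = s.
Proof. by move=> rs; rewrite /= (rep_size rs). Qed.

Lemma link_spec s v E c (x y : 'I_n) (d : R) :
    rep v E c s -> (0 < size v)%N -> nmem s 18 0 = y -> nmem s 23 0 = x ->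
    rmem s 5 0 = d ->
  mkseq (fun t => (nmem (den link s) 13 t, nmem (den link s) 14 t)) (size v) =
    [seq (val e.1, val e.2) | e <- rcons E (ord_edge x y)] /\
  rmem (den link s) 4 0 = c + d.
Proof.
move=> rs v0 ys xs ds; rewrite /= (rep_size rs) v0 ys xs map_rcons -(rep_edges rs).
rewrite /= /ord_edge; case: ifP => _ /=; rewrite ds (rep_cost rs); split=> //;
  by rewrite -[in LHS](prednK v0); apply: mkseq_upd2 => t;
     rewrite /upd /= ?(rep_size rs) ?prednK ?ys ?xs ?subn1.
Qed.

Lemma push_spec s v E c (y : 'I_n) : y \notin v ->
    nmem s 10 0 = size v -> mkseq (nmem s 11) (size v) = map val v ->
    mkseq (fun t => (nmem s 13 t, nmem s 14 t)) (size v) =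
      [seq (val e.1, val e.2) | e <- E] ->
    (forall y : 'I_n, nmem s 15 y = (y \in v)) -> rmem s 4 0 = c ->
    nmem s 18 0 = y ->
  rep (rcons v y) E c (den push s).
Proof.
move=> yv e1 e2 e3 e4 e5 ys; split; rewrite /= ?size_rcons //.
- by rewrite /upd /= e1 addn1.
- by rewrite e1 ys map_rcons -e2 -mkseq_upd.
- move=> z; rewrite mem_rcons inE /upd /= ys -val_eqE.
  by case: eqP => // _; rewrite e4.
Qed.

Opaque nearest link push.

Lemma insert_spec s v E c (y : 'I_n) :
    env s -> rep v E c s -> greedy_tree p v E c -> nmem s 18 0 = y -> (size v <= k)%N ->
  exists E' c', let v' := if (y \notin v) && (size v < k)%N then rcons v y else v in
    rep v' E' c' (den insert s) /\ greedy_tree p v' E' c'.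
Proof.
move=> es rs T ys vk; rewrite /insert /= ys (rep_mem rs) (rep_size rs) (env_k es).
case: (boolP (y \in v)) => yv /=; first by exists E, c.
case: ltnP => lt_vk; last by exists E, c.
have a1 : agree [:: 0; 1; 10; 11; 13; 14; 15; 18]%N [:: 0; 1; 4]%N s (den nearest s).
  by apply: agree_den; vm_compute.
have rs1 : rep v E c (den nearest s) by apply: rep_agree rs; apply: agree_sub a1 _ _.
have ys1 : nmem (den nearest s) 18 0 = y by rewrite a1.1.
have a2 s1 : agree [:: 0; 1; 10; 11; 15; 18]%N [:: 0; 1]%N s1 (den link s1).
  by apply: agree_den; vm_compute.
have [v0|v_gt0] := posnP (size v).
  have {}v0 : v = [::] by case: v v0 {rs T vk yv lt_vk rs1}.
  subst v; have [eE ec] : E = [::] /\ c = 0 by exact: greedy_tree_nil T.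
  subst E c; exists [::], 0; split; last exact: greedy_one.
  rewrite (link_nil rs1); case: rs1 => e1 e2 e3 e4 e5; exact: (@push_spec _ [::]).
have [|x [xv xN xR xmin]] := nearest_spec es rs ys.
  by rewrite v_gt0 (leq_trans vk).
exists (rcons E (ord_edge x y)), (c + edist (p y) (p x)).
split; last exact: greedy_rcons.
have [h1 h2] := link_spec rs1 v_gt0 ys1 xN xR.
case: rs1 (a2 (den nearest s)) => e1 e2 e3 e4 e5 [a3 _].
apply: push_spec => //; rewrite ?a3 //.
  by rewrite -e2; apply: eq_mkseq => t; rewrite a3.
by move=> z; rewrite a3.
Qed.

(** The hypothesis on [b] fixes its value at each point for the whole pass: it may depend only on
    arrays that insertion leaves alone, besides the loop counter. The pass misses a point satisfying
    [q] only if the tree has become full. *)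
Lemma insert_all_spec s v E c b (q : pred 'I_n) :
    env s -> rep v E c s -> greedy_tree p v E c -> (size v <= k)%N ->
    (forall s' (y : 'I_n), agree [:: 0; 1; 7; 8; 22]%N [:: 0; 1; 2; 3]%N s s' ->
       nmem s' 18 0 = y -> beval s' b = q y) ->
  exists v' E' c', [/\ rep v' E' c' (den (insert_all b) s), greedy_tree p v' E' c',
    (size v' <= k)%N /\ {subset v <= v'},
    forall z, z \in v' -> z \in v \/ q z &
    size v' = k \/ forall z, q z -> z \in v'].
Proof.
move=> es rs T vk bq.
pose I i s' := agree [:: 0; 1; 7; 8; 22]%N [:: 0; 1; 2; 3]%N s s' /\
  exists v' E' c', [/\ rep v' E' c' s', greedy_tree p v' E' c',
    (size v' <= k)%N /\ {subset v <= v'},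
    forall z, z \in v' -> z \in v \/ q z &
    size v' = k \/ forall z : 'I_n, (z < i)%N -> q z -> z \in v'].
suff [_ [v' [E' [c' [h1 h2 h3 h4 h5]]]]] : I n (den (insert_all b) s).
  exists v', E', c'; split=> //; case: h5 => h5; [by left | right => z; exact: h5].
apply: den_for; [by vm_compute | exact: env_n es | |].
  split; first exact: agree_setN.
  exists v, E, c; split; [|by []|by split|by left|by right].
  by apply: rep_agree rs; apply: agree_setN.
move=> i s' lt_in ei _ [ag [v' [E' [c' [rs' T' [v'k vv'] vq full]]]]].
pose y := Ordinal lt_in.
have es' : env s' by apply: env_agree es; apply: agree_sub ag _ _.
have ag' : agree [:: 0; 1; 7; 8; 22]%N [:: 0; 1; 2; 3]%N s' (den (when b insert) s').
  by apply: agree_den; vm_compute.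
split; first by apply: agree_trans ag (agree_trans ag' _); apply: agree_setN.
have lt_i1 (z : 'I_n) : (z < i.+1)%N -> (z < i)%N \/ z = y.
  by rewrite ltnS leq_eqVlt => /predU1P[zi|]; [right; apply: val_inj | left].
rewrite [den _ _]/= (bq s' y ag ei); case: (boolP (q y)) => qy; last first.
  exists v', E', c'; split=> //; first by apply: rep_agree rs'; apply: agree_setN.
  case: full => full; [by left | right => z /lt_i1[|->]; first exact: full].
  by rewrite (negbTE qy).
have [E2 [c2 /= [rs2 T2]]] := insert_spec (y := y) es' rs' T' ei v'k.
exists (if (y \notin v') && (size v' < k)%N then rcons v' y else v'), E2, c2.
split=> //; first by apply: rep_agree rs2; apply: agree_setN.
- case: ifP => // /andP[_ lt]; rewrite size_rcons; split=> // z /vv'.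
  by rewrite mem_rcons inE orbC => ->.
- move=> z; case: ifP => _; last exact: vq.
  by rewrite mem_rcons inE => /predU1P[->|/vq //]; right.
- case: full => [e|full]; first by rewrite e ltnn andbF; left.
  case: (boolP (y \in v')) => yv /=.
    by right => z /lt_i1[|->] //; apply: full.
  case: ltnP => lt; last by left; apply/eqP; rewrite eqn_leq v'k.
  right => z /lt_i1[zi qz|->]; rewrite mem_rcons inE ?eqxx //.
  by rewrite full ?orbT.
Qed.

Opaque insert_all.

(** * Greedy covering for a fixed guess of centre and radius *)

Section Guess.
Variables s0 j0 : 'I_n.

Let dist (i j : 'I_n) : R := edist (p i) (p j).
Let r : R := scale p k s0 j0.
Let disk : {set 'I_n} := [set y | dist s0 y <= dist s0 j0].
Let news v x : {set 'I_n} :=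
  [set y in disk | (y \notin [set z in v]) && (dist x y <= r)].
Let near x : pred 'I_n := fun y => (dist s0 y <= dist s0 j0) && (dist x y <= 3 * r).
Let covered (O : {set 'I_n}) (J : seq 'I_n) : {set 'I_n} :=
  [set y in O | has (fun u => dist u y <= r) J].

(* After i rounds, at least i of the balls that cover O are paid for. *)
Let covers_upto (i : nat) v : Prop :=
  forall (O : {set 'I_n}) (J : seq 'I_n),
    (size J <= n)%N -> (k <= #|O|)%N -> (forall y, y \in O -> dist s0 y <= dist s0 j0) ->
    (forall y, y \in O -> exists2 u, u \in J & dist u y <= r) ->
  exists xs J',
    [/\ (size xs + size J' <= size J)%N, (size J' <= size J - i)%N,
        forall y, y \in v -> dist s0 y <= dist s0 j0,
        forall y, y \in v -> exists2 x, x \in xs & dist x y <= 3 * r &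
        (k <= #|[set z in v] :|: covered O J'|)%N].

(** With no ball left, [v] alone accounts for k distinct points, and an extension limited to k
    vertices adds nothing. *)
Lemma full_eq O v v' : uniq v -> uniq v' -> (size v' <= k)%N -> {subset v <= v'} ->
  (k <= #|[set z in v] :|: covered O [::]|)%N -> v' =i v.
Proof.
move=> uv uv' v'k vv' kv x; have [|_ ->//] := uniq_min_size uv vv'.
apply: leq_trans v'k (leq_trans kv _).
rewrite (_ : _ :|: _ = [set z in v]) ?cardsE ?(card_uniqP uv) //.
by apply/setP => y; rewrite !inE andbF orbF.
Qed.

(** If the cover is used up, the tree is frozen by [full_eq]. Otherwise the picked point [x] joins
    [xs] in exchange for one ball of [J'], so the sum of the two sizes does not grow. *)
Lemma covers_upto_step i v v' x : uniq v -> uniq v' ->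
    covers_upto i v -> (forall u, (#|news v u| <= #|news v x|)%N) ->
    (size v' <= k)%N -> {subset v <= v'} ->
    (forall z, z \in v' -> z \in v \/ near x z) ->
    (size v' = k \/ forall z, near x z -> z \in v') ->
  covers_upto i.+1 v'.
Proof.
move=> uv uv' cov xmax v'k vv' v'near full O J Jn kO Od Oc.
have [xs [[|u J'] [h1 h2 vd vxs kc]]] := cov O J Jn kO Od Oc.
  have e := full_eq uv uv' v'k vv' kc; exists xs, [::]; split=> //.
  - by move=> y; rewrite e; apply: vd.
  - by move=> y; rewrite e; apply: vxs.
  - apply: leq_trans kc _; apply/subset_leq_card/setSU/subsetP => y.
    by rewrite !inE => /vv'.
have [J2 [eJ2 kJ2]] : exists J2, size J2 = size J' /\
    (k <= #|[set z in v'] :|: covered O J2|)%N.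
  (* A full tree reaches k by itself, so any ball may be discarded; otherwise the exchange argument
     chooses one. *)
  case: full => [e|full].
    exists J'; split=> //; apply: leq_trans (subset_leq_card (subsetUl _ _)).
    by rewrite cardsE (card_uniqP uv') e.
  apply: (@greedy_cover_step _ _ p r disk O [set z in v] _ x u) => //.
  - by rewrite divr_ge0 ?edist_ge0 ?sqrtr_ge0.
  - by apply/subsetP => y /Od; rewrite inE.
  - exact: xmax.
  - by apply/subsetP => y; rewrite !inE => /vv'.
  - by move=> y; rewrite !inE => yd xy; apply: full; rewrite /near yd.
exists (x :: xs), J2; split=> //.
- by move: h1; rewrite /= eJ2 addnS.
- by move: h2; rewrite /= eJ2; lia.
- by move=> y /v'near[/vd //|/andP[]].
- move=> y /v'near[/vxs[x' x'xs x'y]|/andP[_ xy]].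
    by exists x' => //; rewrite inE x'xs orbT.
  by exists x; rewrite ?mem_head.
Qed.

(** A cover has at most n balls, so none survives n rounds. The tree is then already full, and
    topping it up cannot bring in vertices outside the disk or the balls. *)
Lemma covers_upto_end v v' : uniq v -> uniq v' -> (size v' <= k)%N ->
  {subset v <= v'} -> covers_upto n v -> covers_well p k s0 j0 v'.
Proof.
move=> uv uv' v'k vv' cov O J Jn kO Od Oc.
have [xs [J' [h1 h2 vd vxs kc]]] := cov O J Jn kO Od Oc.
have J'0 : J' = [::] by apply/nilP; rewrite /nilp; lia.
subst J'; have e := full_eq uv uv' v'k vv' kc; exists xs; split.
- by rewrite addn0 in h1.
- by move=> y; rewrite e; apply: vd.
- by move=> y; rewrite e; apply: vxs.
Qed.

Record guess s : Prop := Guess {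
  guess_env :> env s;
  guess_s : nmem s 7 0 = s0;
  guess_j : nmem s 8 0 = j0;
  guess_d : rmem s 2 0 = dist s0 j0;
  guess_r : rmem s 3 0 = r }.

Lemma guess_agree s s' : agree [:: 0; 1; 7; 8]%N [:: 0; 1; 2; 3]%N s s' ->
  guess s -> guess s'.
Proof.
move=> ag [e1 e2 e3 e4 e5]; split; rewrite ?ag.1 ?ag.2 //.
by apply: env_agree e1; apply: agree_sub ag _ _.
Qed.

Lemma in_diskE s (y : 'I_n) : guess s -> nmem s 18 0 = y ->
  beval s in_disk = (dist s0 y <= dist s0 j0).
Proof.
move=> gs ys; rewrite -[LHS]/(~~ (rmem s 2 0 < reval s (rdist (cell 7) (cell 18)))).
by rewrite (@rdistE s (cell 7) (cell 18) s0 y gs (guess_s gs) ys) (guess_d gs) -leNgt.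
Qed.

Opaque in_disk.

Lemma countsE s v E c (x y : 'I_n) : guess s -> rep v E c s ->
  nmem s 17 0 = x -> nmem s 18 0 = y -> beval s counts = (y \in news v x).
Proof.
move=> gs rs xs ys; rewrite [LHS]/= (in_diskE gs ys) !inE; congr [&& _, _ & _].
  by rewrite ys (rep_mem rs y); case: (y \in v).
have /= -> := @rdistE s (cell 17) (cell 18) x y gs xs ys.
by rewrite leNgt (guess_r gs).
Qed.

Opaque counts.

Lemma score_spec s v E c (x : 'I_n) : guess s -> rep v E c s -> nmem s 17 0 = x ->
  nmem (den score s) 20 0 = #|news v x|.
Proof.
move=> gs rs xs.
pose I i s' := agree [:: 0; 1; 7; 8; 10; 11; 13; 14; 15; 17]%N [:: 0; 1; 2; 3; 4]%N s s' /\
  nmem s' 20 0 = #|[set y in news v x | (y < i)%N]|.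
suff [_ ->] : I n (den score s).
  by apply: eq_card => y; rewrite inE ltn_ord andbT.
rewrite -[den score s]/(den score_loop (setN s 20 0 0)).
apply: den_for; [by vm_compute | exact: env_n gs | |].
  split; first exact: agree_trans (agree_setN _ _ _ _ _) (agree_setN _ _ _ _ _).
  by rewrite /= /upd /= eq_card0 // => y; rewrite !inE andbF.
move=> i s' lt_in ei _ [ag Ii]; pose y := Ordinal lt_in.
have gs' : guess s' by apply: guess_agree gs; apply: agree_sub ag _ _.
have rs' : rep v E c s' by apply: rep_agree rs; apply: agree_sub ag _ _.
split.
  apply: agree_trans ag (agree_trans (agree_den _ _ _) (agree_setN _ _ _ _ _)) => //;
  by vm_compute.
have -> : #|[set z in news v x | (z < i.+1)%N]| =
    ((y \in news v x) + #|[set z in news v x | (z < i)%N]|)%N.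
  rewrite (cardsD1 y) inE ltnSn andbT; congr (_ + _)%N; apply: eq_card => z.
  rewrite !inE ltnS leq_eqVlt -val_eqE /=; case: eqP => [->|_] /=; last by [].
  by rewrite ltnn !andbF.
have hb : beval s' counts = (y \in news v x) by apply: (countsE (y := y) gs' rs' _ ei); rewrite ag.1.
rewrite [den _ s']/= hb.
by case: ifP => _; rewrite /= /upd /= Ii ?addn1.
Qed.

Opaque score.

Lemma pick_spec s v E c : guess s -> rep v E c s ->
  exists x : 'I_n, nmem (den pick s) 22 0 = x /\
    forall u, (#|news v u| <= #|news v x|)%N.
Proof.
move=> gs rs.
pose I i s' := agree [:: 0; 1; 7; 8; 10; 11; 13; 14; 15]%N [:: 0; 1; 2; 3; 4]%N s s' /\
  exists x : 'I_n, [/\ nmem s' 22 0 = x, (nmem s' 21 0 <= #|news v x|)%N &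
    forall u : 'I_n, (u < i)%N -> (#|news v u| <= nmem s' 21 0)%N].
suff [_ [x [h1 h2 h3]]] : I n (den pick s).
  by exists x; split=> // u; apply: leq_trans h2; apply: h3.
rewrite -[den pick s]/(den pick_loop (setN (setN s 21 0 0) 22 0 0)).
apply: den_for; [by vm_compute | exact: env_n gs | |].
  split.
    exact: agree_trans (agree_trans (agree_setN _ _ _ _ _) (agree_setN _ _ _ _ _))
      (agree_setN _ _ _ _ _).
  (* The search starts from point 0 with score 0. If no point has a positive score, this default is
     a maximiser. *)
  by exists (Ordinal (leq_trans k_gt0 le_kn)); split.
move=> i s' lt_in ei _ [ag [x [h1 h2 h3]]]; pose y := Ordinal lt_in.
have gs' : guess s' by apply: guess_agree gs; apply: agree_sub ag _ _.
have rs' : rep v E c s' by apply: rep_agree rs; apply: agree_sub ag _ _.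
split.
  apply: agree_trans ag (agree_trans (agree_den _ _ _) (agree_setN _ _ _ _ _)) => //;
  by vm_compute.
have sc := score_spec gs' rs' (x := y) ei.
have e21 : nmem (den score s') 21 0 = nmem s' 21 0 by apply: den_nframe; vm_compute.
have e22 : nmem (den score s') 22 0 = x by rewrite -h1; apply: den_nframe; vm_compute.
have e17 : nmem (den score s') 17 0 = y by rewrite -[RHS]ei; apply: den_nframe; vm_compute.
have lt_i1 (z : 'I_n) : (z < i.+1)%N -> (z < i)%N \/ z = y.
  by rewrite ltnS leq_eqVlt => /predU1P[zi|]; [right; apply: val_inj | left].
rewrite /= e21 sc; case: ltnP => lt; rewrite /= /upd /=.
  exists y; rewrite ?sc ?e17; split=> // u /lt_i1[/h3 h|->] //.
  exact: leq_trans h (ltnW lt).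
exists x; rewrite ?e22 ?e21; split=> // u /lt_i1[/h3 //|->] //.
Qed.

Opaque pick.

Lemma near_pickE s (x y : 'I_n) : guess s -> nmem s 22 0 = x -> nmem s 18 0 = y ->
  beval s near_pick = near x y.
Proof.
move=> gs xs ys; rewrite [LHS]/= (in_diskE gs ys) /near; congr (_ && _).
have := @rdistE s (cell 22) (cell 18) x y gs xs ys.
by rewrite /= (guess_r gs) => ->; rewrite -leNgt.
Qed.

Opaque near_pick.

Lemma rounds_spec s : guess s -> rep [::] [::] 0 s ->
  exists v E c, [/\ rep v E c (den rounds s), greedy_tree p v E c,
    (size v <= k)%N & covers_upto n v].
Proof.
move=> gs rs.
pose I i s' := agree [:: 0; 1; 7; 8]%N [:: 0; 1; 2; 3]%N s s' /\
  exists v E c, [/\ rep v E c s', greedy_tree p v E c,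
    (size v <= k)%N & covers_upto i v].
suff [_ //] : I n (den rounds s).
apply: den_for; [by vm_compute | exact: env_n gs | |].
  split; first exact: agree_setN.
  exists [::], [::], 0; split=> //; first by apply: rep_agree rs; apply: agree_setN.
    exact: greedy_nil.
  move=> O J Jn kO Od Oc; exists [::], J; split=> //; first by rewrite subn0.
  apply: leq_trans kO _; apply/subset_leq_card/subsetP => y yO; rewrite !inE yO /=.
  by apply/hasP; apply: Oc.
move=> i s' lt_in ei _ [ag [v [E [c [rs' T vk cov]]]]].
have gs' : guess s' by exact: guess_agree ag gs.
have [x [xE xmax]] := pick_spec gs' rs'.
have ag1 : agree [:: 0; 1; 7; 8; 10; 11; 13; 14; 15]%N [:: 0; 1; 2; 3; 4]%N s' (den pick s').
  by apply: agree_den; vm_compute.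
have gs1 : guess (den pick s') by apply: guess_agree gs'; apply: agree_sub ag1 _ _.
have rs1 : rep v E c (den pick s') by apply: rep_agree rs'; apply: agree_sub ag1 _ _.
have nearE s2 (y : 'I_n) : agree [:: 0; 1; 7; 8; 22]%N [:: 0; 1; 2; 3]%N (den pick s') s2 ->
    nmem s2 18 0 = y -> beval s2 near_pick = near x y.
  move=> ag2 ys; apply: near_pickE => //; last by rewrite ag2.1.
  by apply: guess_agree gs1; apply: agree_sub ag2 _ _.
have [v' [E' [c' [rs2 T2 [v'k vv'] v'near full]]]] := insert_all_spec gs1 rs1 T vk nearE.
split.
  apply: agree_trans ag (agree_trans (agree_den _ _ _) (agree_setN _ _ _ _ _)) => //;
  by vm_compute.
exists v', E', c'; split=> //; first by apply: rep_agree rs2; apply: agree_setN.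
exact: (covers_upto_step (greedy_tree_uniq T) (greedy_tree_uniq T2) cov xmax).
Qed.

Opaque rounds.

Lemma init_spec s : env s -> nmem s 7 0 = s0 -> nmem s 8 0 = j0 ->
  [/\ guess (den init s), nmem (den init s) 10 0 = 0%N & rmem (den init s) 4 0 = 0].
Proof.
move=> es ss js; have := @rdistE s (cell 7) (cell 8) s0 j0 es ss js.
rewrite /= => dE; split=> //; case: es => e1 e2 e3 e4.
by split; rewrite ?/init /= /upd /= ?dE ?e2.
Qed.

Lemma clear_spec s : nmem s 0 0 = n ->
  forall y : 'I_n, nmem (den clear s) 15 y = 0%N.
Proof.
move=> en; pose I i s' := forall y : 'I_n, (y < i)%N -> nmem s' 15 y = 0%N.
suff H : I n (den clear s) by move=> y; apply: H.
apply: den_for => // i s' lt_in ei _ Ii y; rewrite ltnS leq_eqVlt => yi.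
rewrite /= /upd /= ei; case: eqP => // neq; apply: Ii.
by case/predU1P: yi.
Qed.

Opaque init clear.

Lemma build_spec s : env s -> nmem s 7 0 = s0 -> nmem s 8 0 = j0 ->
  exists v E c, [/\ rep v E c (den build s), greedy_tree p v E c, size v = k &
    covers_well p k s0 j0 v].
Proof.
move=> es ss js; have [gs e10 e4] := init_spec es ss js.
rewrite [den build s]/=; move: (den init s) gs e10 e4 => s1 gs1 e10 e4.
have cl := clear_spec (env_n gs1).
have ag : agree [:: 0; 1; 7; 8; 10]%N [:: 0; 1; 2; 3; 4]%N s1 (den clear s1).
  by apply: agree_den; vm_compute.
have gs2 : guess (den clear s1) by apply: guess_agree gs1; apply: agree_sub ag _ _.
have rs2 : rep [::] [::] 0 (den clear s1) by split; rewrite ?ag.1 ?ag.2.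
have [v [E [c [rs3 T vk cov]]]] := rounds_spec gs2 rs2.
have gs3 : guess (den rounds (den clear s1)).
  by apply: guess_agree gs2; apply: agree_den; vm_compute.
have [v' [E' [c' [rs4 T' [v'k vv'] _ full]]]] :=
  @insert_all_spec _ v E c btrue predT gs3 rs3 T vk (fun _ _ _ _ => erefl).
exists v', E', c'; split=> //; last first.
  exact: covers_upto_end (greedy_tree_uniq T) (greedy_tree_uniq T') v'k vv' cov.
case: full => // full; apply/eqP; rewrite eqn_leq v'k (leq_trans le_kn) //.
rewrite -(card_uniqP (greedy_tree_uniq T')) -[X in (X <= _)%N]card_ord.
by apply/subset_leq_card/subsetP => z _; apply: full.
Qed.

End Guess.

Opaque build.

(** * The shortest candidate over all guesses *)

Definition recorded v E s : Prop :=
  [/\ nmem s 2 0 = k, nmem s 4 0 = k.-1, mkseq (nmem s 3) k = map val v &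
      mkseq (fun t => (nmem s 5 t, nmem s 6 t)) k.-1 =
        [seq (val e.1, val e.2) | e <- E]].

(** [D] holds the guesses tried so far. Rejected candidates are overwritten in memory, so only their
    existence and the comparison of lengths are kept. The first alternative is the sentinel
    state. *)
Definition best (D : 'I_n -> 'I_n -> Prop) s : Prop :=
  (rmem s 6 0 < 0 /\ forall a b, ~ D a b) \/
  exists v E c, [/\ greedy_tree p v E c, size v = k, rmem s 6 0 = c,
    recorded v E s & forall a b, D a b -> exists v' E' c',
      [/\ greedy_tree p v' E' c', size v' = k, covers_well p k a b v' & c <= c']].

Lemma best_agree D s s' : agree [:: 2; 3; 4; 5; 6]%N [:: 6]%N s s' ->
  best D s -> best D s'.
Proof.
move=> [hN hR] [[h1 h2]|[v [E [c [h1 h2 h3 [h4 h5 h6 h7] h8]]]]].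
  by left; rewrite hR.
right; exists v, E, c; split=> //; first by rewrite hR.
split; rewrite ?hN //.
- by rewrite -h6; apply: eq_mkseq => t; rewrite hN.
- by rewrite -h7; apply: eq_mkseq => t; rewrite !hN.
Qed.

Lemma best_sub D D' s : (forall a b, D' a b <-> D a b) -> best D s -> best D' s.
Proof.
move=> DD' [[h1 h2]|[v [E [c [h1 h2 h3 h4 h5]]]]].
  by left; split=> // a b /DD'/h2.
by right; exists v, E, c; split=> // a b /DD'/h5.
Qed.

Lemma copy_spec s : nmem s 0 0 = n -> forall t, (t < n)%N ->
  [/\ nmem (den copy_arrays s) 3 t = nmem s 11 t,
      nmem (den copy_arrays s) 5 t = nmem s 13 t &
      nmem (den copy_arrays s) 6 t = nmem s 14 t].
Proof.
move=> en; pose I i s' := agree [:: 11; 13; 14]%N [::] s s' /\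
  forall t, (t < i)%N -> [/\ nmem s' 3 t = nmem s 11 t,
    nmem s' 5 t = nmem s 13 t & nmem s' 6 t = nmem s 14 t].
suff [_ //] : I n (den copy_arrays s).
apply: den_for => // [|i s' lt_in ei _ [ag Ii]].
  by split=> //; apply: agree_setN.
split.
  by apply: agree_trans ag (agree_trans (agree_den _ _ _) (agree_setN _ _ _ _ _)).
move=> t; rewrite ltnS leq_eqVlt => ti; rewrite /= /upd /= ei.
rewrite (ag.1 11%N) // (ag.1 13%N) // (ag.1 14%N) //.
by case: eqP ti => [-> //|_ /Ii[]].
Qed.

Opaque copy_arrays.

Lemma greedy_tree_ge0 v E c : greedy_tree p v E c -> 0 <= c.
Proof. by elim=> // *; rewrite addr_ge0 ?edist_ge0. Qed.

Lemma keep_best_spec D s v E c a b : env s -> best D s -> rep v E c s ->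
    greedy_tree p v E c -> size v = k -> covers_well p k a b v ->
  best (fun a' b' => D a' b' \/ (a' = a /\ b' = b)) (den keep_best s).
Proof.
move=> es bs rs T vk vcov; have c0 := greedy_tree_ge0 T.
have new : exists v' E' c', [/\ greedy_tree p v' E' c', size v' = k,
    covers_well p k a b v' & c <= c'] by exists v, E, c.
rewrite /keep_best /= (rep_cost rs); case: ifP => h; last first.
  have [h1 h2] : rmem s 6 0 <= c /\ 0 <= rmem s 6 0.
    by split; move: h => /negbFE/andP[]; rewrite -!leNgt.
  case: bs => [[h3 _]|[v' [E' [c' [h3 h4 h5 h6 h7]]]]]; first by rewrite ltNge h2 in h3.
  right; exists v', E', c'; split=> // a' b' [/h7 //|[-> ->]].
  by exists v, E, c; split=> //; rewrite -h5.
have cp := copy_spec (env_n es).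
have ag : agree [:: 0; 1]%N [:: 4; 6]%N s (den copy_arrays s).
  by apply: agree_den; vm_compute.
right; exists v, E, c; split=> //.
- by rewrite /= /upd /= ag.2 // (rep_cost rs).
- split; rewrite /= /upd /= ?ag.1 // ?(env_k es) ?subn1 //.
  + rewrite -(rep_verts rs) vk; apply/eq_in_map => t; rewrite mem_iota /= => tk.
    by have [] := cp t (leq_trans tk le_kn).
  + rewrite -(rep_edges rs) vk; apply/eq_in_map => t; rewrite mem_iota /= => tk.
    by have [|_ -> -> //] := cp t; first lia.
- move=> a' b' [ab|[-> -> //]].
  case: bs => [[_ /(_ _ _ ab)] //|[v' [E' [c' [h3 h4 h5 h6 h7]]]]].
  have [v2 [E2 [c2 [k1 k2 k3 k4]]]] := h7 _ _ ab.
  exists v2, E2, c2; split=> //; apply: le_trans k4.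
  move: h; rewrite negb_and !negbK => /orP[]; rewrite h5; first exact: ltW.
  (* A recorded tree has nonnegative length, which excludes the sentinel branch of the test. *)
  by rewrite ltNge (greedy_tree_ge0 h3).
Qed.

Opaque keep_best.

Lemma main_spec s : env s -> best (fun _ _ => True) (den main s).
Proof.
move=> es; rewrite [den main s]/=.
set s1 := State _ _.
pose J (i : nat) s' := agree [:: 0; 1]%N [:: 0; 1]%N s s' /\
  best (fun a _ => a < i)%N s'.
suff [_] : J n (den search s1).
  by apply: best_sub => a b; split.
apply: den_for; [by vm_compute | exact: env_n es | |].
  split; first by split=> u j; rewrite !inE => /orP[]/eqP->.
  by left; split; rewrite // /upd /= sub0r oppr_lt0.
move=> i s2 lt_in ei en [ag2 bs2]; pose a := Ordinal lt_in.
have es2 : env s2 by apply: env_agree ag2 es.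
(* The guesses tried so far form an initial segment of the lexicographic order on pairs. *)
pose I (j : nat) s' := [/\ agree [:: 0; 1]%N [:: 0; 1]%N s s', nmem s' 7 0 = i &
  best (fun a' b' => a' < i \/ (a' = a /\ b' < j))%N s'].
suff [ag3 _ bs3] : I n (den (PFor 8 (PSeq build keep_best)) s2).
  split; first by apply: agree_trans ag3 _; apply: agree_setN.
  apply: best_agree (agree_setN _ _ _ _ _) _ => //.
  apply: best_sub bs3 => a' b'; rewrite ltnS leq_eqVlt; split.
    by case/predU1P=> [e|]; [right; split=> //; apply: val_inj | left].
  by case=> [->|[-> _]]; rewrite ?orbT ?eqxx.
apply: den_for; [by vm_compute | exact: env_n es2 | |].
  split=> //; first by apply: agree_trans ag2 _; apply: agree_setN.
  apply: best_agree (agree_setN _ _ _ _ _) _ => //.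
  by apply: best_sub bs2 => a' b'; split=> [[|[]]//|]; left.
move=> j s3 lt_jn ej _ [ag3 ei3 bs3]; pose b := Ordinal lt_jn.
have es3 : env s3 by apply: env_agree ag3 es.
have [v [E [c [rs4 T vk vcov]]]] := @build_spec a b s3 es3 ei3 ej.
have ag4 : agree [:: 0; 1]%N [:: 0; 1]%N s3 (den build s3).
  by apply: agree_den; vm_compute.
have bs4 : best (fun a' b' => a' < i \/ (a' = a /\ b' < j))%N (den build s3).
  by apply: best_agree bs3; apply: agree_den; vm_compute.
have bs5 := keep_best_spec (env_agree ag4 es3) bs4 rs4 T vk vcov.
split.
- apply: agree_trans ag3 (agree_trans (agree_den _ _ _) (agree_setN _ _ _ _ _)) => //;
  by vm_compute.
- by rewrite -ei3 /= /upd /= !den_nframe //; vm_compute.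
apply: best_agree (agree_setN _ _ _ _ _) _ => //.
apply: best_sub bs5 => a' b'; rewrite ltnS [(b' <= j)%N]leq_eqVlt; split.
- case=> [|[-> /predU1P[e|]]]; [by do 2!left | | by left; right].
  by right; split=> //; apply: val_inj.
- case=> [[|[-> ->]]|[-> ->]]; [by left | by right; rewrite orbT |].
  by right; rewrite eqxx.
Qed.

End Correctness.

Theorem theorem1p3 (R : realType) :
  exists (P : cmd) (c d : nat) (C : R),
  forall (n k : nat) (p : 'I_n -> R * R), (0 < k <= n)%N ->
  exists (t : nat) (s : state R) (T : graph n),
    [/\ exec P (input k p) t s,
        (t <= c * n ^ d)%N,
        output s T,
        is_tree T /\ (k <= #|verts T|)%N &
        forall T0 : graph n, min_ktree p k T0 ->
          tree_length p T <= C * (k%:R `^ 4^-1) * tree_length p T0].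
Proof.
have [c [d cd]] := ptime_poly main.
exists (compile main), c, d, 756 => n k p /andP[k0 kn].
have es : env k p (input k p).
  by split=> // i /=; rewrite valK.
have [t et tle] := @exec_den R main (input k p) n isT isT (env_n es).
(* The sentinel state is impossible at the end: since 0 < k <= n, at least one guess has been
   tried. *)
have := main_spec k0 kn es; case=> [[_ /(_ (Ordinal (leq_trans k0 kn)))]|].
  by move/(_ (Ordinal (leq_trans k0 kn)) I).
case=> [v [E [len [T vk _ [o1 o2 o3 o4] opt]]]].
exists t, (den main (input k p)), (graph_of v E).
have uv := greedy_tree_uniq T.
split=> //.
- by apply: leq_trans tle (cd n _); apply: leq_trans kn.
- split.
    rewrite o1 o3; apply: perm_map; apply: uniq_perm; rewrite ?enum_uniq //.
    by move=> x; rewrite mem_enum inE.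
  rewrite o2 o4; apply: perm_map; apply: uniq_perm; rewrite ?enum_uniq //.
    exact: greedy_tree_uniq_edges T.
  by move=> x; rewrite mem_enum inE.
- split; last by rewrite /= cardsE (card_uniqP uv) vk.
  by apply: greedy_tree_is_tree T _; rewrite -size_eq0 vk -lt0n.
move=> T0 [[simpT connT _] kT _].
rewrite (greedy_tree_length T).
(* The optimal tree singles out one guess (s, j) in the analysis only; the returned tree is no
   longer than the candidate of that guess, which is the one estimated. *)
have [s [j [J [Jn sT JT JL dL]]]] := optimal_cover p k simpT connT.
have [v' [E' [len' [T' v'k v'cov le]]]] := opt s j I.
apply: le_trans le _.
exact: candidate_length k0 kT Jn sT JT JL dL T' v'k v'cov.
Qed.
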